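(* There exists a dendroid $X \subset \mathbb{R}^2$ such that the hyperspace $\mathcal{S}_c(X)$ of nontrivial convergent sequences of $X$, with the Vietoris topology, has $\mathfrak{c}$-many path-wise connected components (that is, the set of its path components has cardinality $\mathfrak{c}$).
   Context: $\mathfrak{c}$ is the cardinality of the continuum. A dendroid is an arcwise connected, hereditarily unicoherent continuum (a continuum being a compact connected metrizable space; hereditarily unicoherent meaning that the intersection of any two subcontinua is connected); subsets of $\mathbb{R}^2$ carry the subspace topology. For a topological space $X$, $\mathcal{CL}(X)$ denotes the set of all nonempty closed subsets of $X$. For a nonempty family $\mathcal{U}$ of subsets of $X$, $\langle \mathcal{U}\rangle = \{F \in \mathcal{CL}(X) : F \subseteq \bigcup \mathcal{U} \text{ and } F \cap U \neq \emptyset \text{ for all } U \in \mathcal{U}\}$. The Vietoris topology on $\mathcal{CL}(X)$ has as a base the sets $\langle \mathcal{U}\rangle$, where $\mathcal{U}$ runs over all nonempty finite families of nonempty open subsets of $X$; every subset of $\mathcal{CL}(X)$ carries the subspace topology. A nontrivial convergent sequence of $X$ is a subset $S \subseteq X$ such that $|S| = \omega$ (countably infinite), $S$ (as a subspace) has a unique non-isolated point $x_S$, and $S \setminus U$ is finite for each neighborhood $U$ of $x_S$. Then $\mathcal{S}_c(X) = \{S \in \mathcal{CL}(X) : S \text{ is a nontrivial convergent sequence}\}$. *)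

(* Defs.v *)
From HB Require Import structures.
From mathcomp Require Import all_boot all_order all_algebra.
From mathcomp Require Import all_classical all_reals all_analysis homotopy.
Set Implicit Arguments.
Unset Strict Implicit.
Unset Printing Implicit Defensive.
Import Order.TTheory GRing.Theory Num.Theory.
Import numFieldNormedType.Exports.
Local Open Scope classical_set_scope.
Local Open Scope ring_scope.

(* [0, 1] with the topology induced by R, bipointed by its endpoints, so that
   the paths of the library can be used. *)
Definition unit_interval (R : realType) : Type := `[0%R : R, 1%R]%classic.
HB.instance Definition _ (R : realType) :=
  Topological.copy (unit_interval R) (set_type `[0%R : R, 1%R]%classic).

Section unit_interval.
Variable R : realType.

Let I0_subproof : (0 : R) \in `[0%R : R, 1%R]%classic.
Proof. by rewrite inE /= in_itv /= lexx ler01. Qed.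

Let I1_subproof : (1 : R) \in `[0%R : R, 1%R]%classic.
Proof. by rewrite inE /= in_itv /= lexx ler01. Qed.

Definition I0 : unit_interval R := exist _ 0 I0_subproof.
Definition I1 : unit_interval R := exist _ 1 I1_subproof.

Let I0_neq_I1 : I0 != I1.
Proof. by apply/eqP => /(congr1 val)/= /esym/eqP; rewrite oner_eq0. Qed.

HB.instance Definition _ := isBiPointed.Build (unit_interval R) I0_neq_I1.
End unit_interval.

Section continua.
Variables (R : realType).

Definition metrizable (T : topologicalType) : Prop :=
  exists d : T -> T -> R,
    [/\ forall x y, d x y = 0 <-> x = y,
        forall x y, d x y = d y x,
        forall x y z, d x z <= d x y + d y z
      & forall (x : T) (A : set T),
          nbhs x A <-> exists2 e, 0 < e & [set y | d x y < e] `<=` A].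

Definition continuum (T : topologicalType) : Prop :=
  [/\ compact [set: T], connected [set: T] & metrizable T].

Definition hereditarily_unicoherent (T : topologicalType) : Prop :=
  forall K L : set T, continuum K -> continuum L -> connected (K `&` L).

(* [p] is a homeomorphism of [0, 1] onto its image. *)
Definition is_arc (T : topologicalType) (x y : T)
    (p : {path unit_interval R from x to y}) : Prop :=
  exists2 g : T -> unit_interval R,
    cancel p g & {within range p, continuous g}.

Definition arcwise_connected (T : topologicalType) : Prop :=
  forall x y : T, x <> y ->
    exists p : {path unit_interval R from x to y}, is_arc p.

Definition dendroid (T : topologicalType) : Prop :=
  [/\ continuum T, arcwise_connected T & hereditarily_unicoherent T].

Definition path_component (T : topologicalType) (x : T) : set T :=
  [set y | $| {path unit_interval R from x to y} | ].

Definition path_components (T : topologicalType) : set (set T) :=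
  range (@path_component T).

End continua.
Arguments path_component R T x : clear implicits.
Arguments path_components R T : clear implicits.

Section hyperspace.
Variable X : topologicalType.

(* A separate name, so that [CL] only ever carries the Vietoris topology. *)
Definition CL : Type := [set F : set X | closed F /\ F !=set0].
HB.instance Definition _ :=
  Choice.copy CL (set_type [set F : set X | closed F /\ F !=set0]).

Definition CL_set (F : CL) : set X := \val F.

Lemma CL_setP (F : CL) : closed (CL_set F) /\ CL_set F !=set0.
Proof. exact: set_mem (valP F). Qed.

Definition vietoris_index : set (set (set X)) :=
  [set U | [/\ finite_set U, U !=set0
             & forall V, U V -> open V /\ V !=set0]].

Definition vietoris_basic (U : set (set X)) : set CL :=
  [set F | CL_set F `<=` \bigcup_(V in U) V /\
           forall V, U V -> CL_set F `&` V !=set0].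

Let vietoris_cover : \bigcup_(U in vietoris_index) vietoris_basic U = setT.
Proof.
apply/seteqP; split=> // F _; have [_ [x Fx]] := CL_setP F.
exists [set setT]; last by split=> [y _|_ ->]; [exists setT|exists x].
split; [exact: finite_set1|by exists setT|move=> _ ->].
by split; [exact: openT|exists x].
Qed.

Let vietoris_join (U V : set (set X)) (F : CL) :
  vietoris_index U -> vietoris_index V ->
  vietoris_basic U F -> vietoris_basic V F ->
  exists W, [/\ vietoris_index W, vietoris_basic W F &
               vietoris_basic W `<=` vietoris_basic U `&` vietoris_basic V].
Proof.
move=> [finU U0 oU] [finV V0 oV] [FU FUn] [FV FVn].
set uU := \bigcup_(A in U) A; set uV := \bigcup_(A in V) A.
have ouU : open uU by apply: bigcup_open => A /oU[].
have ouV : open uV by apply: bigcup_open => A /oV[].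
have meetU A : U A -> CL_set F `&` (A `&` uV) !=set0.
  by move=> /FUn[x [Fx Ax]]; exists x; split=> //; split=> //; exact: FV.
have meetV A : V A -> CL_set F `&` (A `&` uU) !=set0.
  by move=> /FVn[x [Fx Ax]]; exists x; split=> //; split=> //; exact: FU.
exists ([set A `&` uV | A in U] `|` [set A `&` uU | A in V]); split.
- split.
  + by rewrite finite_setU; split; apply: finite_image.
  + by case: U0 => A UA; exists (A `&` uV); left; exists A.
  + move=> _ [[A UA <-]|[A VA <-]]; split.
    * by apply: openI => //; have [] := oU _ UA.
    * by have [x [_ ?]] := meetU _ UA; exists x.
    * by apply: openI => //; have [] := oV _ VA.
    * by have [x [_ ?]] := meetV _ VA; exists x.
- split; last by move=> _ [[A UA <-]|[A VA <-]]; [exact: meetU|exact: meetV].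
  move=> x Fx; have [A UA Ax] := FU _ Fx.
  exists (A `&` uV); first by left; exists A.
  by split=> //; exact: FV.
- move=> G [GW GWn]; split; split.
  + move=> x /GW[_ [[A UA <-]|[A VA <-]] [Ax //]]; by exists A.
  + move=> A UA; have [|x [Gx [Ax _]]] := GWn (A `&` uV).
      by left; exists A.
    by exists x.
  + move=> x /GW[_ [[A UA <-]|[A VA <-]] [Ax //]]; by exists A.
  + move=> A VA; have [|x [Gx [Ax _]]] := GWn (A `&` uU).
      by right; exists A.
    by exists x.
Qed.

HB.instance Definition _ :=
  isBaseTopological.Build CL vietoris_cover vietoris_join.

Definition nontrivial_convergent_sequence (S : set X) : Prop :=
  (S #= [set: nat])%card /\
  exists xS : X, S `\` isolated S = [set xS] /\
    forall U : set X, nbhs xS U -> finite_set (S `\` U).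

Definition Sc : set CL :=
  [set F | nontrivial_convergent_sequence (CL_set F)].

End hyperspace.
Arguments Sc X : clear implicits.

(* Main.v *)
Require Import Defs.
From mathcomp Require Import all_boot all_order all_algebra.
From mathcomp Require Import all_classical all_reals all_analysis homotopy.
From mathcomp Require Import ring lra.
Import Order.TTheory GRing.Theory Num.Theory.
Import numFieldNormedType.Exports.
Set Implicit Arguments.
Unset Strict Implicit.
Unset Printing Implicit Defensive.
Local Open Scope classical_set_scope.
Local Open Scope ring_scope.

(** Let X be the union of a vertical segment, the spine from (0, 0) to (0, 1), and of
two fans of segments (teeth) that accumulate on it: teeth of slope n+1 starting
upwards from (0, 0) on the right, and the images of these by the half-turn about
(0, 1/2), starting downwards from (0, 1) on the left.  The n-th tooth stops at height
[a n], where the sequence [a] is dense in the unit interval ([dense_teeth]).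

X is a dendroid.  Its points are joined by polygonal arcs of at most three pieces, and
each of these arcs is contained in every subcontinuum through its ends
([double_fan_arc]): a connected set that leaves a tooth does so through its vertex
([exit_tooth]), and a subcontinuum cannot skip a point of the spine
([spine_forced]).  Hence the intersection of two subcontinua is arcwise connected.

Now fix y in the open unit interval.  Some tips of right teeth and some tips of left
teeth converge to (0, y).  Together with (0, y) they form a convergent sequence that is
stuck: its points on the right teeth can only move down, those on the left teeth
can only move up, and the limit can do neither.  Precisely, consider the property of a
convergent sequence A that it meets almost all of the selected right teeth above some
fixed positive height, and almost all of the selected left teeth below some fixed
height less than 1.  It
forces the limit of A to be (0, y) ([trapped_limit]), since the selected teeth stop at
heights that tend to y.  It is also locally constant along Vietoris paths
([trapped_invariant]): at a given time A is countable, so it omits some height s; for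
all nearby times it still omits s, and then whether it meets a given tooth above s
cannot change, with the same time interval for all teeth.  So sequences stuck at different
points of the spine are in different path components, which gives as many components as
real numbers ([components_ge]).

Conversely, a closed subset of the plane is determined by the rational balls that it
misses, so there are at most as many convergent sequences, and path components, as real
numbers ([components_le]). *)

(** * Planar preliminaries and the double fan *)

Lemma pair_continuous (R : realType) (T : topologicalType) (f g : T -> R) :
  continuous f -> continuous g -> continuous (fun t => (f t, g t)).
Proof.
move=> cf cg t; apply: (@cvg_pair _ _ _ (nbhs t) (nbhs (f t)) (nbhs (g t))).
- exact: cf.
- exact: cg.
Qed.

Lemma comp_continuous (S T U : topologicalType) (f : S -> T) (g : T -> U) :
  continuous f -> continuous g -> continuous (fun t => g (f t)).
Proof.
move=> cf cg t; apply: (@continuous_comp _ _ _ f g); [exact: cf|exact: cg].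
Qed.

Section plane.
Variable R : realType.
Implicit Types (z w : R * R) (K A : set (R * R)).

(** The half-turn about (0, 1/2), the centre of symmetry of the double fan; it
exchanges the two fans and the two ends of the spine. *)
Definition flip z : R * R := (- z.1, 1 - z.2).

Lemma flipK : involutive flip.
Proof. by case=> x y; rewrite /flip /= opprK subKr. Qed.

Lemma affine_continuous (b c d : R) :
  continuous (fun z : R * R => b * z.1 + c * z.2 + d).
Proof.
move=> z; apply: cvgD; last exact: cvg_cst.
apply: cvgD; apply: cvgM; (try exact: cvg_cst); [exact: cvg_fst|exact: cvg_snd].
Qed.

Lemma open_half_plane (b c d : R) :
  open [set z : R * R | 0 < b * z.1 + c * z.2 + d].
Proof.
apply: (@open_comp _ _ (fun z => b * z.1 + c * z.2 + d) [set x | 0 < x]).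
  by move=> z _; exact: affine_continuous.
exact: open_gt.
Qed.

Lemma closed_half_plane (b c d : R) :
  closed [set z : R * R | 0 <= b * z.1 + c * z.2 + d].
Proof.
apply: (@preimage_closed _ _ (fun z => b * z.1 + c * z.2 + d) [set x | 0 <= x]).
  by move=> z _; exact: affine_continuous.
exact: closed_ge.
Qed.

Lemma open_above (s : R) : open [set z : R * R | s < z.2].
Proof.
rewrite [X in open X](_ : _ = [set z | 0 < 0 * z.1 + 1 * z.2 + - s]).
  exact: open_half_plane.
by apply/seteqP; split=> z /=; lra.
Qed.

Lemma closed_above (s : R) : closed [set z : R * R | s <= z.2].
Proof.
rewrite [X in closed X](_ : _ = [set z | 0 <= 0 * z.1 + 1 * z.2 + - s]).
  exact: closed_half_plane.
by apply/seteqP; split=> z /=; lra.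
Qed.

Lemma flip_continuous : continuous flip.
Proof.
apply: pair_continuous => z; first by apply: cvgN; exact: cvg_fst.
by apply: cvgB; [exact: cvg_cst|exact: cvg_snd].
Qed.

Lemma image_flipE A : flip @` A = flip @^-1` A.
Proof.
apply/seteqP; split=> [_ [z Az <-]|z Az] /=; first by rewrite flipK.
by exists (flip z); rewrite ?flipK.
Qed.

Lemma open_flip A : open A -> open (flip @^-1` A).
Proof. by move=> oA; apply: open_comp => // z _; exact: flip_continuous. Qed.

Lemma closed_flip A : closed A -> closed (flip @^-1` A).
Proof. by move=> oA; apply: preimage_closed => // z _; exact: flip_continuous. Qed.

Lemma connected_flip A : connected A -> connected (flip @^-1` A).
Proof.
move=> cA; rewrite -image_flipE; apply: connected_continuous_connected => //.
exact/continuous_subspaceT/flip_continuous.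
Qed.

Lemma ball_plane (p z : R * R) (e : R) :
  `|p.1 - z.1| < e -> `|p.2 - z.2| < e -> ball p e z.
Proof. by move=> h1 h2; split; rewrite -ball_normE. Qed.

Lemma ball_planeP (p z : R * R) (e : R) :
  ball p e z -> `|p.1 - z.1| < e /\ `|p.2 - z.2| < e.
Proof. by move=> [] /=; rewrite -!ball_normE. Qed.

Variable a : nat -> R.
Hypothesis a01 : forall n, 0 <= a n <= 1.

(** The n-th tooth is the segment of slope n+1 issuing from the origin and cut
off at height [a n].  The teeth accumulate on the spine, the segment from
(0, 0) to (0, 1). *)
Definition tooth n : set (R * R) :=
  [set z | [/\ 0 <= z.2, z.2 <= a n & z.2 = n.+1%:R * z.1]].

Definition fan : set (R * R) :=
  [set z | z.1 = 0 /\ 0 <= z.2 <= 1 \/ exists n, tooth n z].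

Definition double_fan : set (R * R) := fan `|` flip @^-1` fan.

Lemma double_fan_flip z : double_fan (flip z) = double_fan z.
Proof. by rewrite /double_fan /setU /preimage /= flipK propeqE; tauto. Qed.

Lemma tooth_bounds n z : tooth n z -> 0 <= z.1 <= n.+1%:R^-1 /\ 0 <= z.2 <= 1.
Proof.
move=> [z0 za zE]; have /andP[a0 a1] := a01 n.
have z1 : z.2 <= 1 by exact: le_trans a1.
split; last exact/andP.
have -> : z.1 = n.+1%:R^-1 * z.2 by rewrite zE mulrA mulVf ?mul1r ?gt_eqF.
have n1 : 0 < n.+1%:R^-1 :> R by rewrite invr_gt0.
apply/andP; split; first by rewrite mulr_ge0// ltW.
by apply: ler_piMr => //; exact: ltW.
Qed.

Lemma fan_bounds z : fan z -> 0 <= z.1 <= 1 /\ 0 <= z.2 <= 1.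
Proof.
move=> [[-> ->]|[n /tooth_bounds[/andP[-> h] ->]]]; first by rewrite lexx ler01.
by split=> //=; apply: (le_trans h); rewrite invf_le1 ?ler1n.
Qed.

Lemma double_fan_bounds z : double_fan z -> -1 <= z.1 <= 1 /\ 0 <= z.2 <= 1.
Proof. by move=> [/fan_bounds|/fan_bounds/=] [] /andP[? ?] /andP[? ?]; lra. Qed.

Lemma double_fan_gt0 z : double_fan z -> 0 < z.1 -> exists2 n, tooth n z & 0 < z.2.
Proof.
move=> [[[-> _]|[n Tz]]|/fan_bounds/= [/andP[? ?] _]] z0; [by lra| |by lra].
by exists n => //; case: Tz => _ _ ->; rewrite mulr_gt0.
Qed.

Lemma double_fan_eq0 z : double_fan z -> z.1 = 0 -> 0 <= z.2 <= 1.
Proof. by move=> /double_fan_bounds[]. Qed.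

Lemma double_fan_lt0 z : double_fan z -> z.1 < 0 ->
  exists2 n, tooth n (flip z) & z.2 < 1.
Proof.
rewrite -double_fan_flip => /double_fan_gt0 + z0 => /(_ _)[|n Tn h]; first by rewrite /=; lra.
by exists n => //; move: h => /=; lra.
Qed.

Lemma tooth_double_fan n z : tooth n z -> double_fan z.
Proof. by move=> Tz; left; right; exists n. Qed.

Lemma spine_double_fan (h : R) : 0 <= h <= 1 -> double_fan (0, h).
Proof. by move=> ?; left; left. Qed.

Definition tooth_pt n (h : R) : R * R := (n.+1%:R^-1 * h, h).

Lemma tooth_pt_tooth n h : 0 <= h <= a n -> tooth n (tooth_pt n h).
Proof. by move=> /andP[? ?]; split=> //=; rewrite mulrA divff ?mul1r ?gt_eqF. Qed.

Lemma toothE n z : tooth n z -> z = tooth_pt n z.2.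
Proof.
by case: z => x y [/= _ _ ->]; rewrite /tooth_pt mulrA mulVf ?mul1r ?gt_eqF.
Qed.

(** An open sector around the line of slope n+1, so narrow that it meets the
double fan in the n-th tooth without its vertex, see [double_fan_cone].  This
is how a tooth minus its vertex is both open and closed away from the
vertex. *)
Definition cone n : set (R * R) :=
  [set z | (n%:R + 1/2) * z.1 < z.2 < (n%:R + 3/2) * z.1].

Lemma cone_open n : open (cone n).
Proof.
have -> : cone n = [set z | 0 < (- (n%:R + 1/2)) * z.1 + 1 * z.2 + 0] `&`
     [set z | 0 < (n%:R + 3/2) * z.1 + (-1) * z.2 + 0].
  by apply/seteqP; split=> z /= => [/andP|] [h1 h2]; [split|apply/andP; split]; lra.
by apply: openI; exact: open_half_plane.
Qed.

Lemma cone_gt0 n z : cone n z -> 0 < z.1.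
Proof. by rewrite /cone/= => /andP[? ?]; lra. Qed.

Lemma tooth_cone n z : tooth n z -> 0 < z.2 -> cone n z.
Proof.
move=> [_ _ e] h; have z0 : 0 < z.1 by move: h; rewrite e pmulr_rgt0.
by rewrite /cone /= e -[n.+1%:R]natr1; apply/andP; split; lra.
Qed.

Lemma tooth_coneP n m z : tooth m z -> cone n z -> m = n.
Proof.
move=> [_ _ e] cz; have z0 := cone_gt0 cz; move: cz; rewrite /cone /= e.
rewrite !ltr_pM2r// -[m.+1%:R]natr1 => /andP[h1 h2].
apply/eqP; rewrite eqn_leq -(ltnS m n) -(ltnS n m) -!(ltr_nat R).
rewrite -[n.+1%:R]natr1 -[m.+1%:R]natr1.
by apply/andP; split; lra.
Qed.

Lemma double_fan_cone n z : double_fan z -> cone n z -> tooth n z.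
Proof.
move=> Xz cz; have [m Tm _] := double_fan_gt0 Xz (cone_gt0 cz).
by rewrite -(tooth_coneP Tm cz).
Qed.

End plane.

(** * Subcontinua of the double fan *)

Section forced.
Variable R : realType.
Variable a : nat -> R.
Hypothesis a01 : forall n, 0 <= a n <= 1.
Implicit Types (z w : R * R) (K A : set (R * R)).
Local Notation double_fan := (double_fan a).

Lemma small_natV (e : R) : 0 < e -> exists n, n.+1%:R^-1 < e.
Proof.
move=> e0; have [n _ /(_ n (leqnn n))/= h] := near_infty_natSinv_lt (PosNum e0).
by exists n.
Qed.

Lemma closed_tooth n : closed (tooth a n).
Proof.
have -> : tooth a n = [set z | 0 <= 0 * z.1 + 1 * z.2 + 0] `&`
   ([set z | 0 <= 0 * z.1 + (-1) * z.2 + a n] `&`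
   ([set z | 0 <= n.+1%:R * z.1 + (-1) * z.2 + 0] `&`
    [set z | 0 <= (- n.+1%:R) * z.1 + 1 * z.2 + 0])).
  apply/seteqP; split=> z /= => [[? ? e]|[? [? [? ?]]]].
    by split; [lra|split; [lra|split; rewrite e; lra]].
  by split; [lra|lra|apply/eqP; rewrite eq_le; apply/andP; split; lra].
by do !apply: closedI; exact: closed_half_plane.
Qed.

Definition wedge n : set (R * R) :=
  [set z | [/\ 0 <= z.1, 0 <= z.2, z.2 <= 1 & n.+1%:R * z.1 <= z.2]].

Lemma closed_wedge n : closed (wedge n).
Proof.
have -> : wedge n = [set z | 0 <= 1 * z.1 + 0 * z.2 + 0] `&`
   ([set z | 0 <= 0 * z.1 + 1 * z.2 + 0] `&`
   ([set z | 0 <= 0 * z.1 + (-1) * z.2 + 1] `&`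
    [set z | 0 <= (- n.+1%:R) * z.1 + 1 * z.2 + 0])).
  apply/seteqP; split=> z /= => [[? ? ? ?]|[? [? [? ?]]]].
    by split; [lra|split; [lra|split; lra]].
  by split; lra.
by do !apply: closedI; exact: closed_half_plane.
Qed.

(** Writing the fan as an intersection of finite unions of closed sets shows that
it is closed: for each n, all but n teeth lie in the wedge between the line of
slope n+1 and the vertical axis, and these wedges shrink to the spine. *)
Lemma fanE : fan a =
  \bigcap_(n in setT) (wedge n `|` \bigcup_(k in `I_n) tooth a k).
Proof.
apply/seteqP; split=> z.
  move=> [[z1 /andP[z0 z2]] n _|[m Tm] n _].
    by left; split; rewrite ?z1 ?mulr0.
  have [mn|nm] := ltnP m n; first by right; exists m.
  have [/andP[x0 _] /andP[y0 y1]] := tooth_bounds a01 Tm.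
  by left; split=> //; case: Tm => _ _ ->; rewrite ler_wpM2r// ler_nat.
move=> zn; have [[n Tn]|nT] := pselect (exists n, tooth a n z).
  by right; exists n.
have zw n : wedge n z.
  by case: (zn n I) => // -[k _ Tk]; case: nT; exists k.
have [x0 y0 y1 _] := zw 0; left; rewrite y0 y1; split=> //.
apply/eqP; rewrite eq_le x0 andbT leNgt; apply/negP => z0.
have [n nz] := small_natV z0; have [_ _ _ h] := zw n.
have : n.+1%:R * z.1 <= 1 by exact: le_trans h y1.
by rewrite -ler_pdivlMl// mulr1 leNgt nz.
Qed.

Lemma closed_double_fan : closed double_fan.
Proof.
have fc : closed (fan a).
  rewrite fanE; apply: closed_bigI => n _; apply: closedU.
    exact: closed_wedge.
  by apply: closed_bigcup => // k _; exact: closed_tooth.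
by apply: closedU => //; exact: closed_flip.
Qed.

Lemma compact_double_fan : compact double_fan.
Proof.
apply: (subclosed_compact closed_double_fan (compact_setX
  (@segment_compact _ (-1) 1) (@segment_compact _ 0 1))).
by move=> z /(double_fan_bounds a01)[h1 h2]; split; rewrite /= in_itv.
Qed.

(** A connected set that leaves a tooth does so through the vertex: the part of a
tooth above height s is open in the double fan, and its only boundary point is
the point of that tooth at height s. *)
Lemma exit_tooth K n (s : R) z w : K `<=` double_fan -> connected K ->
  K z -> cone n z -> 0 <= s < z.2 -> K w -> ~ (cone n w /\ s < w.2) ->
  K (tooth_pt n s).
Proof.
move=> KX cK Kz cz /andP[s0 sz] Kw; apply: contra_notP => nK.
pose B := K `&` (cone n `&` [set z | s < z.2]).
suff : B = K by move=> BK; have [_ []] : B w by rewrite BK.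
apply: cK; first by exists z.
- exists (cone n `&` [set z | s < z.2]) => //.
  by apply: openI; [exact: cone_open|exact: open_above].
- exists (tooth a n `&` [set z | s <= z.2]).
  by apply: closedI; [exact: closed_tooth|exact: closed_above].
apply/seteqP; split=> [u [Ku [cu su]]|u [Ku [Tu su]]].
  by split=> //; split; [exact: double_fan_cone (KX _ Ku) cu|exact: ltW].
have {}su : s < u.2.
  rewrite lt_neqAle su andbT; apply/eqP => e; apply: nK.
  by rewrite e -(toothE Tu).
by split=> //; split=> //; apply: tooth_cone Tu _; exact: le_lt_trans su.
Qed.

(** On the fan, this continuous function sends the first N+1 teeth to 0 and is the
height on the other teeth and on the spine, see [collapse_tooth]; it is also
the height on the other fan, see [collapse_le0]. *)
Definition collapse N z : R :=
  Num.min z.2 (Num.max 0 (N.+2%:R * (z.2 - N.+1%:R * z.1))).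

Lemma collapse_continuous N : continuous (collapse N).
Proof.
move=> z; apply: continuous_min; first exact: cvg_snd.
apply: continuous_max; first exact: cvg_cst.
apply: cvgM; first exact: cvg_cst.
apply: cvgB; first exact: cvg_snd.
by apply: cvgM; [exact: cvg_cst|exact: cvg_fst].
Qed.

Lemma collapse_le0 N z : z.1 <= 0 -> 0 <= z.2 -> collapse N z = z.2.
Proof.
move=> x0 y0; rewrite /collapse; apply/min_idPl; rewrite le_max; apply/orP; right.
have : N.+1%:R * z.1 <= 0 by rewrite mulr_ge0_le0.
have : 1 <= N.+2%:R :> R by rewrite ler1n.
by nra.
Qed.

Lemma collapse_tooth N n z : tooth a n z ->
  collapse N z = 0 \/ collapse N z = z.2 /\ N.+1%:R * z.1 <= z.2.
Proof.
move=> [y0 _ e]; have x0 : 0 <= z.1 by move: y0; rewrite e pmulr_rge0.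
rewrite /collapse e -mulrBl; have [nN|Nn] := leqP n N; [left|right].
  rewrite (_ : Num.max _ _ = 0).
    by apply/min_idPr; rewrite mulr_ge0.
  apply/max_idPl; rewrite mulr_ge0_le0// mulr_le0_ge0//.
  by rewrite subr_le0 ler_nat.
have Nn' : N.+2%:R <= n.+1%:R :> R by rewrite ler_nat.
split; last by rewrite ler_wpM2r// ler_nat leqW.
apply/min_idPl; rewrite le_max; apply/orP; right; rewrite mulrA ler_wpM2r//.
have : 1 <= N.+1%:R :> R by rewrite ler1n.
by move: Nn'; rewrite -[N.+2%:R]natr1; nra.
Qed.

(** A subcontinuum cannot jump over a point of the spine by using the teeth:
collapsing the first teeth of both fans onto the ends of the spine gives a
continuous function f, and by the intermediate value theorem K contains a point
with f equal to s.  Such a point has height s and lies on the spine or on a far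
tooth, hence arbitrarily near to (0, s); then (0, s) is in K because K is
closed. *)
Lemma spine_forced K (s1 s2 s : R) : K `<=` double_fan -> closed K -> connected K ->
  K (0, s1) -> K (0, s2) -> s1 <= s <= s2 -> K (0, s).
Proof.
move=> KX clK cK K1 K2 /andP[]; rewrite le_eqVlt => /predU1P[<-//|s1s].
rewrite le_eqVlt => /predU1P[->//|ss2].
have /andP[/= s10 s11] := double_fan_eq0 a01 (KX _ K1) erefl.
have /andP[/= s20 s21] := double_fan_eq0 a01 (KX _ K2) erefl.
apply: contrapT => nK.
have [e /= e0 be] : nbhs_ball (0, s) (~` K).
  by apply/nbhs_ballP; apply: open_nbhs_nbhs; split=> //; exact: closed_openC.
have [N Ne] := small_natV e0.
(* On the right fan the collapse of the flipped point is its height, and on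
   the left fan [collapse N z] is the height of z, so that in each case the
   height cancels and one collapse remains. *)
pose f z := collapse N z + (1 - collapse N (flip z)) - z.2.
have cf : continuous f.
  move=> z; apply: cvgB; last exact: cvg_snd.
  apply: cvgD; first exact: collapse_continuous.
  apply: cvgB; first exact: cvg_cst.
  apply: (@continuous_comp _ _ _ (@flip R)); first exact: flip_continuous.
  exact: collapse_continuous.
have f0 h : 0 <= h <= 1 -> f (0, h) = h.
  move=> /andP[h0 h1]; rewrite /f !collapse_le0 //= ?oppr0//; lra.
have /connected_intervalP fK : connected (f @` K).
  by apply: connected_continuous_connected => //; exact: continuous_subspaceT.
have [z Kz fz] : (f @` K) s.
  apply: (fK s1 s2); [exists (0, s1)|exists (0, s2)|] => //.
  - by rewrite f0 ?s10.
  - by rewrite f0 ?s20.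
  - by rewrite (ltW s1s) (ltW ss2).
suff [zs zx] : z.2 = s /\ `|z.1| < e.
  by apply: (be z) => //; apply: ball_plane; rewrite /= ?zs ?subrr ?normr0// sub0r normrN.
have Xz := KX _ Kz; have [_ /andP[y0 y1]] := double_fan_bounds a01 Xz.
have small (x y : R) : 0 <= x -> y <= 1 -> N.+1%:R * x <= y -> `|x| < e.
  move=> x0 yl h; rewrite ger0_norm//; apply: le_lt_trans Ne.
  by rewrite -[leRHS]mulr1 ler_pdivlMl//; exact: le_trans yl.
have [x0|x0|x0] := ltgtP z.1 0.
- have [n Tn _] := double_fan_lt0 a01 Xz x0.
  have fE : f z = 1 - collapse N (flip z).
    by rewrite /f collapse_le0 ?(ltW x0)//; lra.
  have [c0|[cz h]] := collapse_tooth N Tn; first by lra.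
  split; first by move: fz; rewrite fE cz /=; lra.
  by rewrite -normrN; apply: small h => /=; lra.
- have [n Tn _] := double_fan_gt0 a01 Xz x0.
  have fE : f z = collapse N z.
    by rewrite /f [collapse N (flip z)]collapse_le0 /=; lra.
  have [c0|[cz h]] := collapse_tooth N Tn; first by lra.
  split; first by move: fz; rewrite fE cz /=; lra.
  by apply: small h => //; exact: ltW.
- have zE : z = (0, z.2) by case: z x0 {Kz fz Xz y0 y1} => ? ? /= ->.
  by split; [rewrite -fz [in RHS]zE f0// y0|rewrite x0 normr0].
Qed.

End forced.

(** * Arcs of the double fan *)

Section arcs.
Variable R : realType.
Variable a : nat -> R.
Hypothesis a01 : forall n, 0 <= a n <= 1.
Implicit Types (z w x y : R * R) (K A : set (R * R)).
Local Notation double_fan := (double_fan a).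

(** An arc of the double fan contained in every subcontinuum through its ends.
Such arcs give at once arcwise connectedness and hereditary unicoherence: if x
and y are in K and L, then so is the arc. *)
Definition forced_arc x y := exists g : R -> R * R,
  [/\ continuous g, g 0 = x, g 1 = y,
      {in `[0, 1] &, injective g} &
      forall t, 0 <= t <= 1 -> double_fan (g t) /\
        forall K, K `<=` double_fan -> closed K -> connected K ->
          K x -> K y -> K (g t)].

Lemma flip_inj : injective (@flip R).
Proof. exact: (inv_inj (@flipK R)). Qed.

Lemma forced_arc_flip x y : forced_arc x y -> forced_arc (flip x) (flip y).
Proof.
move=> [g [cg gx gy ig gK]]; exists (@flip R \o g); split; rewrite /= ?gx ?gy//.
- by move=> t; apply: continuous_comp; [exact: cg|exact: flip_continuous].
- by move=> s t Is It /flip_inj; exact: ig.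
- move=> t /gK[Xg fg]; split; first by rewrite double_fan_flip.
  move=> K KX clK cK Kx Ky; apply: (fg (@flip R @^-1` K)) => //.
  + by move=> z /KX; rewrite double_fan_flip.
  + exact: closed_flip.
  + exact: connected_flip.
Qed.

Lemma forced_arc_of_curve (g : R -> R * R) (l r : R) :
  continuous g -> injective g -> (forall t, l <= t <= r -> double_fan (g t)) ->
  (forall K (s t u : R), K `<=` double_fan -> closed K -> connected K ->
     s <= t <= u -> K (g s) -> K (g u) -> K (g t)) ->
  forall s t, l <= s <= r -> l <= t <= r -> g s <> g t ->
  forced_arc (g s) (g t).
Proof.
move=> cg ig gX gK s t /andP[ls sr] /andP[lt tr] gst.
have st : t - s != 0.
  by rewrite subr_eq0; apply: contra_not_neq gst => ->.
exists (fun u => g (s + u * (t - s))); split.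
- apply: (comp_continuous _ cg) => u; apply: cvgD; first exact: cvg_cst.
  by apply: cvgM; [exact: cvg_id|exact: cvg_cst].
- by rewrite mul0r addr0.
- by rewrite mul1r subrKC.
- by move=> u v _ _ /ig /addrI /(mulIf st).
- move=> u /andP[u0 u1]; split.
    by apply: gX; apply/andP; split; nra.
  move=> K KX clK cK Ks Kt; have [ts|ts] := leP s t.
    by apply: (gK K s _ t) => //; apply/andP; split; nra.
  by apply: (gK K t _ s) => //; apply/andP; split; nra.
Qed.

Lemma cone_tooth_pt n (h : R) : 0 < h -> cone n (tooth_pt n h).
Proof.
move=> h0; apply: (@tooth_cone _ (fun=> h)) => //; apply: tooth_pt_tooth.
by rewrite ltW/=.
Qed.

Lemma cone_tooth_ptP n m (h : R) : 0 <= h -> cone n (tooth_pt m h) -> m = n.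
Proof.
move=> h0; apply: (@tooth_coneP _ (fun=> h)); apply: tooth_pt_tooth.
by rewrite h0/=.
Qed.

(** A parametrization of the n-th tooth from its tip to its vertex (negative t),
then of the spine (t in [0, 1]), then of the m-th tooth of the other fan (t
above 1).  Any two points that are not on different teeth of one fan lie on a
common bridge. *)
Definition bridge n m (t : R) : R * R :=
  (n.+1%:R^-1 * Num.max 0 (- t) - m.+1%:R^-1 * Num.max 0 (t - 1),
   `|t| - 2 * Num.max 0 (t - 1)).

Lemma bridge_le0 n m t : t <= 0 -> bridge n m t = tooth_pt n (- t).
Proof.
move=> t0; rewrite /bridge (max_idPr _) ?oppr_ge0// (max_idPl _); last by lra.
by rewrite ler0_norm// !mulr0 !subr0.
Qed.

Lemma bridge01 n m t : 0 <= t <= 1 -> bridge n m t = (0, t).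
Proof.
move=> /andP[t0 t1]; rewrite /bridge (max_idPl _) ?oppr_le0//.
by rewrite (max_idPl _) ?subr_le0// ger0_norm// !mulr0 !subr0.
Qed.

Lemma bridge_ge1 n m t : 1 <= t -> bridge n m t = flip (tooth_pt m (t - 1)).
Proof.
move=> t1; rewrite /bridge /flip /tooth_pt /= (max_idPl _) ?oppr_le0; last by lra.
rewrite (max_idPr _) ?subr_ge0// ger0_norm; last by lra.
by rewrite mulr0 sub0r; congr pair; lra.
Qed.

Lemma bridge_flip n m t : flip (bridge m n (1 - t)) = bridge n m t.
Proof.
have [t0|t0] := leP t 0.
  by rewrite bridge_ge1 ?bridge_le0 ?flipK//; [congr tooth_pt|]; lra.
have [t1|t1] := leP t 1.
  rewrite !bridge01; [|lra|lra].
  by rewrite /flip/=; congr pair; lra.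
rewrite bridge_le0 ?bridge_ge1; [|lra|lra].
by congr (flip (tooth_pt _ _)); lra.
Qed.

Lemma maxr_continuous (f : R -> R) :
  continuous f -> continuous (fun t => Num.max 0 (f t)).
Proof. by move=> cf t; apply: continuous_max; [exact: cvg_cst|exact: cf]. Qed.

Lemma bridge_continuous n m : continuous (bridge n m).
Proof.
have cm1 : continuous (fun t : R => Num.max 0 (- t)).
  by apply: maxr_continuous => t; exact: opp_continuous.
have cm2 : continuous (fun t : R => Num.max 0 (t - 1)).
  by apply: maxr_continuous => t; apply: cvgB; [exact: cvg_id|exact: cvg_cst].
apply: pair_continuous => t.
  by apply: cvgB; (apply: cvgM; [exact: cvg_cst|]); [exact: cm1|exact: cm2].
apply: cvgB; first exact: norm_continuous.
by apply: cvgM; [exact: cvg_cst|exact: cm2].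
Qed.

(** On a bridge the sign of the abscissa tells which of the three pieces a point
is on, and there the parameter is an affine function of the height. *)
Lemma bridge_inj n m : injective (bridge n m).
Proof.
pose k z : R := if 0 < z.1 then - z.2 else if z.1 < 0 then 2 - z.2 else z.2.
apply: (can_inj (g := k)) => t; rewrite /k.
have [t0|t0] := ltP t 0.
  by rewrite bridge_le0 ?ltW//= mulr_gt0 ?invr_gt0 ?oppr_gt0// opprK.
have [t1|t1] := leP t 1; first by rewrite bridge01 ?t0//= ltxx.
rewrite bridge_ge1 ?(ltW t1)//=.
have h : 0 < m.+1%:R^-1 * (t - 1) by rewrite mulr_gt0 ?invr_gt0 ?subr_gt0.
rewrite oppr_gt0 oppr_lt0 h ltNge (ltW h) /=; lra.
Qed.

Lemma bridge_double_fan n m t : - a n <= t <= 1 + a m -> double_fan (bridge n m t).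
Proof.
move=> /andP[nt tm]; have [t0|t0] := leP t 0.
  rewrite bridge_le0//; apply: (@tooth_double_fan _ _ n); apply: tooth_pt_tooth.
  by apply/andP; split; lra.
have [t1|t1] := leP t 1.
  by rewrite bridge01 ?(ltW t0)//; apply: spine_double_fan; rewrite ?(ltW t0).
rewrite bridge_ge1 ?(ltW t1)// double_fan_flip.
apply: (@tooth_double_fan _ _ m); apply: tooth_pt_tooth.
by apply/andP; split; lra.
Qed.

Lemma bridge_forced_le0 n m K s t u : K `<=` double_fan -> connected K ->
  s <= t <= u -> t <= 0 -> K (bridge n m s) -> K (bridge n m u) ->
  K (bridge n m t).
Proof.
move=> KX cK /andP[]; rewrite le_eqVlt => /predU1P[<-//|st] tu t0 Ks Ku.
have s0 : s < 0 by lra.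
rewrite bridge_le0//; apply: (exit_tooth a01 KX cK Ks _ _ Ku).
- by rewrite bridge_le0 ?ltW//; apply: cone_tooth_pt; lra.
- by rewrite bridge_le0 ?(ltW s0)//=; apply/andP; split; lra.
have [u0|u0] := leP u 0.
  by rewrite bridge_le0//= => -[_]; lra.
suff u1 : (bridge n m u).1 <= 0 by move=> [/cone_gt0]; lra.
have [u1|u1] := leP u 1; first by rewrite bridge01// (ltW u0).
rewrite bridge_ge1 ?(ltW u1)//= oppr_le0 mulr_ge0// ?invr_ge0//.
by rewrite subr_ge0 ltW.
Qed.

(** On the first tooth, [bridge_forced_le0] applies; the last tooth follows by the
half-turn.  On the spine, the given points are first moved to the spine along
the teeth, after which [spine_forced] applies. *)
Lemma bridge_forced n m K s t u : K `<=` double_fan -> closed K -> connected K ->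
  s <= t <= u -> K (bridge n m s) -> K (bridge n m u) -> K (bridge n m t).
Proof.
move=> KX clK cK /andP[st tu] Ks Ku.
have le0 v : v <= 0 -> s <= v <= u -> K (bridge n m v).
  by move=> v0 svu; apply: bridge_forced_le0 Ks Ku.
have ge1 v : 1 <= v -> s <= v <= u -> K (bridge n m v).
  move=> v1 /andP[sv vu]; rewrite -bridge_flip.
  apply: (@bridge_forced_le0 m n (@flip R @^-1` K) (1 - u) _ (1 - s)).
  - by move=> z /KX; rewrite double_fan_flip.
  - exact: connected_flip.
  - by apply/andP; split; lra.
  - lra.
  - by rewrite /preimage/= bridge_flip.
  - by rewrite /preimage/= bridge_flip.
have [t0|t0] := leP t 0; first by apply: le0 => //; rewrite st.
have [t1|t1] := leP 1 t; first by apply: ge1 => //; rewrite st.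
have t01 : 0 <= t <= 1 by rewrite !ltW.
have [v [v0 vt Kv]] : exists v : R, [/\ 0 <= v, v <= t & K (0, v)].
  have [s0|s0] := leP s 0.
    exists 0; split; rewrite ?(ltW t0)//.
    have <- : bridge n m 0 = (0, 0) by rewrite bridge01 ?lexx ?ler01.
    by apply: le0 => //; rewrite s0 (le_trans (ltW t0)).
  exists s; split; rewrite ?(ltW s0)//.
  by rewrite -(@bridge01 n m)// (ltW s0) (le_trans st)// ltW.
have [w [w0 wt Kw]] : exists w : R, [/\ t <= w, w <= 1 & K (0, w)].
  have [u1|u1] := leP 1 u.
    exists 1; split; rewrite ?(ltW t1)//.
    have <- : bridge n m 1 = (0, 1) by rewrite bridge01 ?lexx ?ler01.
    by apply: ge1 => //; rewrite u1 (le_trans st (ltW t1)).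
  exists u; split; rewrite ?(ltW u1)//.
  by rewrite -(@bridge01 n m)// (ltW u1) (le_trans (ltW t0)).
by rewrite bridge01//; apply: (spine_forced a01 KX clK cK Kv Kw); rewrite vt.
Qed.

Lemma bridge_arc n m s t : - a n <= s <= 1 + a m -> - a n <= t <= 1 + a m ->
  bridge n m s <> bridge n m t -> forced_arc (bridge n m s) (bridge n m t).
Proof.
apply: (@forced_arc_of_curve (bridge n m) (- a n) (1 + a m)).
- exact: bridge_continuous.
- exact: bridge_inj.
- exact: bridge_double_fan.
- by move=> *; apply: bridge_forced; eassumption.
Qed.

(** The union of two teeth of the same fan: the n-th one for negative t, the m-th
one for positive t, with the vertex at t = 0. *)
Definition vee n m (t : R) : R * R :=
  (n.+1%:R^-1 * Num.max 0 (- t) + m.+1%:R^-1 * Num.max 0 t, `|t|).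

Lemma vee_le0 n m t : t <= 0 -> vee n m t = tooth_pt n (- t).
Proof.
move=> t0; rewrite /vee (max_idPr _) ?oppr_ge0// (max_idPl _)//.
by rewrite ler0_norm// mulr0 addr0.
Qed.

Lemma veeN n m t : vee n m (- t) = vee m n t.
Proof. by rewrite /vee opprK addrC normrN. Qed.

Lemma vee_ge0 n m t : 0 <= t -> vee n m t = tooth_pt m t.
Proof. by move=> t0; rewrite -veeN vee_le0 ?oppr_le0// opprK. Qed.

Lemma vee_continuous n m : continuous (vee n m).
Proof.
have cm1 : continuous (fun t : R => Num.max 0 (- t)).
  by apply: maxr_continuous => t; exact: opp_continuous.
have cm2 : continuous (fun t : R => Num.max 0 t).
  by apply: maxr_continuous => t; exact: cvg_id.
apply: pair_continuous => t; last exact: norm_continuous.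
by apply: cvgD; (apply: cvgM; [exact: cvg_cst|]); [exact: cm1|exact: cm2].
Qed.

Lemma vee_inj n m : n != m -> injective (vee n m).
Proof.
move=> nm.
have key (t : R) : 0 < t -> vee n m (- t) <> vee n m t.
  move=> t0; rewrite vee_le0 ?oppr_le0 ?(ltW t0)// vee_ge0 ?(ltW t0)// opprK.
  move=> /(congr1 fst)/= /(mulIf (lt0r_neq0 t0)) /invr_inj /eqP.
  by rewrite eqr_nat eqSS (negbTE nm).
move=> s t e; have /eqP := congr1 snd e.
rewrite /= eqr_norm2 => /orP[/eqP//|/eqP st]; move: e; rewrite st.
have [t0|t0|->] := ltgtP t 0; last by rewrite oppr0.
- by move=> e; case: (key (- t)); rewrite ?oppr_gt0// opprK.
- by move=> /key; case.
Qed.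

Lemma vee_forced_le0 n m K s t u : n != m -> K `<=` double_fan -> connected K ->
  s <= t <= u -> t <= 0 -> K (vee n m s) -> K (vee n m u) ->
  K (vee n m t).
Proof.
move=> nm KX cK /andP[]; rewrite le_eqVlt => /predU1P[<-//|st] tu t0 Ks Ku.
have s0 : s < 0 by lra.
rewrite vee_le0//; apply: (exit_tooth a01 KX cK Ks _ _ Ku).
- by rewrite vee_le0 ?ltW//; apply: cone_tooth_pt; lra.
- by rewrite vee_le0 ?(ltW s0)//=; apply/andP; split; lra.
have [u0|u0] := leP u 0.
  by rewrite vee_le0//= => -[_]; lra.
rewrite vee_ge0 ?(ltW u0)// => -[/cone_tooth_ptP e _].
by move: nm; rewrite e ?eqxx// ltW.
Qed.

Lemma vee_arc n m s t : n != m -> - a n <= s <= a m -> - a n <= t <= a m ->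
  vee n m s <> vee n m t -> forced_arc (vee n m s) (vee n m t).
Proof.
move=> nm; apply: (@forced_arc_of_curve (vee n m) (- a n) (a m)).
- exact: vee_continuous.
- exact: vee_inj.
- move=> u /andP[nu um]; have [u0|u0] := leP u 0.
    rewrite vee_le0//; apply: (@tooth_double_fan _ _ n); apply: tooth_pt_tooth.
    by apply/andP; split; lra.
  rewrite vee_ge0 ?(ltW u0)//; apply: (@tooth_double_fan _ _ m); apply: tooth_pt_tooth.
  by rewrite (ltW u0).
- move=> K u v w KX clK cK /andP[uv vw] Ku Kw; have [v0|v0] := leP v 0.
    by apply: (vee_forced_le0 nm KX cK _ v0 Ku Kw); rewrite uv.
  rewrite -veeN; apply: (@vee_forced_le0 _ _ _ (- w) _ (- u)); rewrite ?veeN//.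
  - by rewrite eq_sym.
  - by rewrite !lerN2 vw.
  - by rewrite oppr_le0 ltW.
Qed.

Lemma forced_arc_sym x y : forced_arc x y -> forced_arc y x.
Proof.
move=> [g [cg gx gy ig gK]]; exists (fun t => g (1 - t)).
split; rewrite ?subrr ?subr0//.
- apply: (comp_continuous _ cg) => t.
  by apply: cvgB; [exact: cvg_cst|exact: cvg_id].
- move=> s t; rewrite !in_itv/= => /andP[s0 s1] /andP[t0 t1] e.
  have := ig (1 - s) (1 - t); rewrite !in_itv/= => /(_ _ _ e) h.
  by apply/oppr_inj/(@addrI _ 1)/h; apply/andP; split; lra.
- move=> t t01; have [|Xt Kt] := gK (1 - t); first by lra.
  by split=> // K KX clK cK Ky Kx; exact: Kt.
Qed.

Lemma double_fan_cases z : double_fan z ->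
  [\/ exists n (h : R), 0 <= h <= a n /\ z = tooth_pt n h,
      exists h : R, 0 <= h <= 1 /\ z = (0, h) |
      exists n (h : R), 0 <= h <= a n /\ z = flip (tooth_pt n h)].
Proof.
move=> Xz; have [z0|z0|z0] := ltgtP z.1 0.
- have [n Tn _] := double_fan_lt0 a01 Xz z0; apply: Or33; exists n, (flip z).2.
  by rewrite -(toothE Tn) flipK; case: Tn => -> ->.
- have [n Tn _] := double_fan_gt0 a01 Xz z0; apply: Or31; exists n, z.2.
  by rewrite -(toothE Tn); case: Tn => -> ->.
- apply: Or32; exists z.2; split; first exact: (double_fan_eq0 a01 Xz z0).
  by rewrite -z0; case: (z).
Qed.

Lemma teeth_arc n m h k : 0 <= h <= a n -> 0 <= k <= a m ->
  tooth_pt n h <> tooth_pt m k -> forced_arc (tooth_pt n h) (tooth_pt m k).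
Proof.
have [->|nm] := eqVneq n m; move=> /andP[h0 hn] /andP[k0 km].
  have E v : 0 <= v -> tooth_pt m v = bridge m m (- v).
    by move=> v0; rewrite bridge_le0 ?oppr_le0// opprK.
  have /andP[am0 _] := a01 m.
  by rewrite !E//; apply: bridge_arc; apply/andP; split; lra.
have [E1 E2] : tooth_pt n h = vee n m (- h) /\ tooth_pt m k = vee n m k.
  by rewrite vee_le0 ?oppr_le0// opprK vee_ge0.
have /andP[am0 _] := a01 m; have /andP[an0 _] := a01 n.
by rewrite E1 E2; apply: vee_arc => //; apply/andP; split; lra.
Qed.

Lemma tooth_spine_arc n h k : 0 <= h <= a n -> 0 <= k <= 1 ->
  tooth_pt n h <> (0, k) -> forced_arc (tooth_pt n h) (0, k).
Proof.
move=> /andP[h0 hn] /andP[k0 k1].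
have /andP[an0 _] := a01 n.
rewrite -(@bridge01 n n k) ?k0// -{1 2}[h]opprK -(@bridge_le0 n n) ?oppr_le0//.
by apply: bridge_arc; apply/andP; split; lra.
Qed.

Lemma tooth_flip_arc n m h k : 0 <= h <= a n -> 0 <= k <= a m ->
  tooth_pt n h <> flip (tooth_pt m k) ->
  forced_arc (tooth_pt n h) (flip (tooth_pt m k)).
Proof.
move=> /andP[h0 hn] /andP[k0 km].
have E : flip (tooth_pt m k) = bridge n m (1 + k).
  by rewrite bridge_ge1 ?lerDl// addrAC subrr add0r.
have /andP[an0 _] := a01 n; have /andP[am0 _] := a01 m.
rewrite E -{1 2}[h]opprK -(@bridge_le0 n m) ?oppr_le0//.
by apply: bridge_arc; apply/andP; split; lra.
Qed.

Lemma spine_arc (h k : R) : 0 <= h <= 1 -> 0 <= k <= 1 ->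
  (0, h) <> (0, k) :> R * R -> forced_arc (0, h) (0, k).
Proof.
move=> h01 k01; rewrite -(@bridge01 0 0 h)// -(@bridge01 0 0 k)//.
have /andP[a0 _] := a01 0.
by apply: bridge_arc; apply/andP; split; lra.
Qed.

Lemma flip_spine (h : R) : (0, h) = flip (0, 1 - h).
Proof. by rewrite /flip/= oppr0; congr pair; lra. Qed.

Lemma double_fan_arc x y : double_fan x -> double_fan y -> x <> y -> forced_arc x y.
Proof.
move=> /double_fan_cases[[n [h [hn ->]]]|[h [h01 ->]]|[n [h [hn ->]]]];
move=> /double_fan_cases[[m [k [km ->]]]|[k [k01 ->]]|[m [k [km ->]]]] xy.
- exact: teeth_arc.
- exact: tooth_spine_arc.
- exact: tooth_flip_arc.
- by apply/forced_arc_sym/tooth_spine_arc => // e; exact: xy.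
- exact: spine_arc.
- rewrite flip_spine; apply/forced_arc_flip/forced_arc_sym/tooth_spine_arc => //.
    by lra.
  by move=> e; apply: xy; rewrite e -flip_spine.
- by apply/forced_arc_sym/tooth_flip_arc => // e; exact: xy.
- rewrite flip_spine; apply/forced_arc_flip/tooth_spine_arc => //; first by lra.
  by move=> e; apply: xy; rewrite e -flip_spine.
- by apply/forced_arc_flip/teeth_arc => // e; apply: xy; rewrite e.
Qed.

End arcs.

(** * Subspaces as types, and the unit interval *)

Section subtypes.

Lemma sub_continuous (S T : topologicalType) (A : set T) (f : S -> set_type A) :
  continuous (fun s => \val (f s)) -> continuous f.
Proof. exact: (@continuous_comp_initial _ _ _ (@set_val _ A)). Qed.

Lemma val_continuous (T : topologicalType) (A : set T) :
  continuous (fun x : set_type A => \val x).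
Proof. exact: (@initial_continuous _ _ (@set_val _ A)). Qed.

Lemma compact_sub (T : topologicalType) (A : set T) :
  compact A -> compact [set: set_type A].
Proof.
move=> cA; have [->|/set0P[x0 _]] := eqVneq [set: set_type A] set0.
  exact: compact0.
pose r z := if pselect (A z) is left h then exist _ z (mem_set h) else x0.
have -> : [set: set_type A] = r @` A.
  apply/seteqP; split=> // -[z zA] _; exists z; first exact: set_mem.
  rewrite /r; case: pselect => [h|[]]; last exact: set_mem.
  exact: val_inj.
apply: continuous_compact => //; apply: sub_continuous.
have cid : {within A, continuous (fun z : T => z)}.
  by apply: continuous_subspaceT => z; exact: cvg_id.
have e : {in A, (fun z : T => z) =1 (fun z => \val (r z))}.
  by move=> z /set_mem Az; rewrite /r; case: pselect.
exact: (subspace_eq_continuous e cid).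
Qed.

Lemma hausdorff_sub (T : topologicalType) (A : set T) :
  hausdorff_space T -> hausdorff_space (set_type A).
Proof.
move=> hT x y xy; apply: val_inj; apply: hT => U V /val_continuous Ux /val_continuous Vy.
by have [z [Uz Vz]] := xy _ _ Ux Vy; exists (\val z).
Qed.

Lemma connected_from_pairs (T : topologicalType) (A : set T) :
  (forall x y, A x -> A y -> exists C, [/\ C `<=` A, connected C, C x & C y]) ->
  connected A.
Proof.
move=> h B [b Bb] [U oU BU] [V cV BV].
have BA : B `<=` A by rewrite BU => x [].
apply/seteqP; split=> // y Ay; have [C [CA cC Cb Cy]] := h b y (BA _ Bb) Ay.
suff BC : B `&` C = C by have [] : (B `&` C) y by rewrite BC.
apply: cC; first by exists b.
- by exists U => //; rewrite BU setIC setIA (setIidl CA).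
- by exists V => //; rewrite BV setIC setIA (setIidl CA).
Qed.

(** The usual fact that a continuous injection of a compact space into a Hausdorff
space is an embedding. *)
Lemma embedding_inverse (S T : topologicalType) (p : S -> T) (s0 : S) :
  compact [set: S] -> hausdorff_space T -> continuous p -> injective p ->
  exists2 g : T -> S, cancel p g & {within range p, continuous g}.
Proof.
move=> cS hT cp ip; pose g t := xget s0 [set s | p s = t].
have gK : cancel p g.
  by move=> s; rewrite /g; case: xgetP => [u _ /ip//|/(_ s)]; case.
exists g => //; apply/continuous_closedP => C clC; apply/closed_subspaceP.
exists (p @` C).
  apply: compact_closed => //; apply: continuous_compact.
    exact: continuous_subspaceT.
  by apply: (subclosed_compact clC cS).
apply/seteqP; split=> [_ [[s Cs <-] _]|t [+ [s _ ps]]] .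
  by split; [change (C (g (p s))); rewrite gK|exists s].
by change (C (g t) -> (p @` C `&` range p) t); rewrite -ps gK; split; exists s.
Qed.

End subtypes.

Section unit_interval.
Variable R : realType.

Lemma clamp_subproof (t : R) : Num.max 0 (Num.min 1 t) \in `[0%R : R, 1%R]%classic.
Proof. by rewrite inE /= in_itv /= le_max lexx ge_max ler01 ge_min lexx. Qed.

(** Precomposition with this retraction turns paths into maps defined on the whole
line. *)
Definition clamp (t : R) : unit_interval R :=
  exist _ (Num.max 0 (Num.min 1 t)) (clamp_subproof t).

Lemma clampE (t : R) : 0 <= t <= 1 -> \val (clamp t) = t.
Proof. by move=> /andP[t0 t1] /=; rewrite (min_idPr t1) (max_idPr t0). Qed.

Lemma clamp_val (u : unit_interval R) : clamp (\val u) = u.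
Proof. by apply: val_inj; apply: clampE; have := set_valP u; rewrite /= in_itv. Qed.

Lemma clamp0 : clamp 0 = I0 R.
Proof. by apply: val_inj; rewrite clampE // lexx ler01. Qed.

Lemma clamp1 : clamp 1 = I1 R.
Proof. by apply: val_inj; rewrite clampE // lexx ler01. Qed.

Lemma clamp_continuous : continuous clamp.
Proof.
apply: (@sub_continuous _ _ _ clamp) => t.
apply: continuous_max; first exact: cvg_cst.
by apply: continuous_min; [exact: cvg_cst|exact: cvg_id].
Qed.

Lemma unit_interval_image : [set: unit_interval R] = clamp @` `[0, 1]%classic.
Proof.
apply/seteqP; split=> // u _; exists (\val u); last exact: clamp_val.
exact: set_valP.
Qed.

Lemma compact_unit_interval : compact [set: unit_interval R].
Proof.
rewrite unit_interval_image; apply: continuous_compact.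
  exact/continuous_subspaceT/clamp_continuous.
exact: segment_compact.
Qed.

Lemma connected_unit_interval : connected [set: unit_interval R].
Proof.
rewrite unit_interval_image; apply: connected_continuous_connected.
  exact/connected_intervalP/interval_is_interval.
exact/continuous_subspaceT/clamp_continuous.
Qed.

End unit_interval.

(** * The double fan is a dendroid *)

Section dendroid.
Variable R : realType.
Variable a : nat -> R.
Hypothesis a01 : forall n, 0 <= a n <= 1.
Local Notation X := (set_type (double_fan a)).

Lemma metrizable_sub (A : set (R * R)) : metrizable R (set_type A).
Proof.
exists (fun x y => `|\val x - \val y|); split.
- move=> x y; split=> [/eqP|->]; last by rewrite subrr normr0.
  by rewrite normr_eq0 subr_eq0 => /eqP/val_inj.
- by move=> x y; rewrite distrC.
- by move=> x y z; rewrite -[\val x - \val z](subrKA (\val y)) ler_normD.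
- move=> x B; split=> [/nbhs_ballP[e /= e0 be]|[e e0 be]].
    by exists e => // y /= xy; apply: be; rewrite -initial_ballE /= ball_prod_normE.
  apply/nbhs_ballP; exists e => //= y; rewrite -initial_ballE /= ball_prod_normE.
  exact: be.
Qed.

Lemma double_fan_path (x y : X) : x <> y ->
  exists p : {path unit_interval R from x to y}, injective p /\
    forall K : set (R * R), K `<=` double_fan a -> closed K -> connected K ->
      K (\val x) -> K (\val y) -> forall u, K (\val (p u)).
Proof.
move=> xy; have [|g [cg g0 g1 ig gK]] :=
  double_fan_arc a01 (set_valP x) (set_valP y).
  by move=> /val_inj.
have u01 (u : unit_interval R) : 0 <= \val u <= 1.
  by have := set_valP u; rewrite /= in_itv.
pose p (u : unit_interval R) : X := exist _ (g (\val u)) (mem_set (gK _ (u01 u)).1).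
have cp : continuous p.
  apply: sub_continuous; apply: (comp_continuous _ cg).
  exact: (@val_continuous _ `[0%R : R, 1%R]%classic).
have p0 : p zero = x by apply: val_inj; exact: g0.
have p1 : p one = y by apply: val_inj; exact: g1.
exists (mk_path cp p0 p1); split.
  move=> u v /(congr1 \val)/= e; apply: val_inj; apply: ig e.
    by rewrite in_itv/= u01.
  by rewrite in_itv/= u01.
by move=> K KX clK cK Kx Ky u; have [_] := gK _ (u01 u); exact.
Qed.

(** The form in which forced arcs are used, both for the double fan and for the
intersection of two subcontinua. *)
Lemma connected_between (A : set X) :
  (forall x y, A x -> A y -> x <> y ->
     exists2 p : {path unit_interval R from x to y}, True & range p `<=` A) ->
  connected A.
Proof.
move=> h; apply: connected_from_pairs => x y Ax Ay.
have [<-|xy] := pselect (x = y).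
  by exists [set x]; split=> // [_ ->//|]; exact: connected1.
have [p _ pA] := h x y Ax Ay xy.
exists (range p); split=> //.
- apply: connected_continuous_connected; first exact: connected_unit_interval.
  exact/continuous_subspaceT/cts_fun.
- by exists zero => //; exact: path_zero.
- by exists one => //; exact: path_one.
Qed.

Lemma continuum_image (K : set X) : continuum R K ->
  closed ((fun x : X => \val x) @` K) /\ connected ((fun x : X => \val x) @` K).
Proof.
move=> [cK nK _]; have -> : (fun x : X => \val x) @` K =
    (fun k : K => \val (\val k)) @` setT.
  apply/seteqP; split=> [_ [x Kx <-]|_ [k _ <-]].
    by exists (exist _ x (mem_set Kx)).
  by exists (\val k) => //; exact: set_valP.
have cv : continuous (fun k : K => \val (\val k)).
  apply: (comp_continuous _ (@val_continuous _ (double_fan a))).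
  exact: (@val_continuous _ K).
split.
  apply: compact_closed; first exact: norm_hausdorff.
  by apply: continuous_compact => //; exact: continuous_subspaceT.
by apply: connected_continuous_connected => //; exact: continuous_subspaceT.
Qed.

Theorem dendroid_double_fan : dendroid R X.
Proof.
split.
- split; last exact: metrizable_sub.
    by apply: compact_sub; exact: compact_double_fan.
  by apply: connected_between => x y _ _ /double_fan_path[p _]; exists p.
- move=> x y /double_fan_path[p [ip _]]; exists p.
  apply: embedding_inverse => //.
  + exact: (I0 R).
  + exact: compact_unit_interval.
  + by apply: hausdorff_sub; exact: norm_hausdorff.
  + exact: cts_fun.
- move=> K L /continuum_image[clK cK] /continuum_image[clL cL].
  have sub (M : set X) : (fun x : X => \val x) @` M `<=` double_fan a.
    by move=> _ [x _ <-]; exact: set_valP.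
  have imE (M : set X) x : ((fun x : X => \val x) @` M) (\val x) -> M x.
    by move=> [z Mz /val_inj <-].
  apply: connected_between => x y [Kx Lx] [Ky Ly] /double_fan_path[p [_ pK]].
  exists p => // _ [u _ <-]; split; apply: imE; apply: pK => //.
  all: by [exists x | exists y].
Qed.

End dendroid.

(** * Vietoris open sets and convergent sequences *)

Section vietoris.
Variable T : topologicalType.

Lemma open_vietoris_basic (U : set (set T)) :
  vietoris_index U -> open (vietoris_basic U).
Proof. by move=> iU; exists [set U]; [move=> _ ->|rewrite bigcup_set1]. Qed.

Lemma open_meets (U : set T) : open U ->
  open [set F : CL T | CL_set F `&` U !=set0].
Proof.
move=> oU; have [->|/set0P[x Ux]] := eqVneq U set0.
  rewrite [X in open X](_ : _ = set0); first exact: open0.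
  by rewrite -subset0 => F [z []].
rewrite [X in open X](_ : _ = vietoris_basic [set setT; U]).
  apply: open_vietoris_basic; split; first exact: finite_set2.
    by exists setT; left.
  by move=> V [->|->]; split=> //; [exact: openT|exists x|exists x].
apply/seteqP; split=> F /= => [FU|[_ FU]]; last by apply: FU; right.
have [_ [z Fz]] := CL_setP F; split=> [w _|V [->|->//]].
  by exists setT => //; left.
by exists z.
Qed.

Lemma open_misses (C : set T) : closed C ->
  open [set F : CL T | CL_set F `&` C = set0].
Proof.
move=> cC; have [C0|/set0P[x Cx]] := eqVneq (~` C) set0.
  rewrite [X in open X](_ : _ = set0); first exact: open0.
  rewrite -subset0 => F /= FC; have [_ [z Fz]] := CL_setP F.
  have : C z by apply: contrapT => nCz; have : (~` C) z by []; rewrite C0.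
  by move=> Cz; have : (CL_set F `&` C) z by []; rewrite FC.
rewrite [X in open X](_ : _ = vietoris_basic [set ~` C]).
  apply: open_vietoris_basic; split; first exact: finite_set1.
    by exists (~` C).
  by move=> V ->; split; [exact: closed_openC|exists x].
apply/seteqP; split=> F /=.
  move=> /disjoints_subset FC; split=> [z /FC Cz|V ->]; first by exists (~` C).
  by have [_ [z Fz]] := CL_setP F; exists z; split=> //; exact: FC.
by move=> [FC _]; apply/disjoints_subset => z /FC[V ->].
Qed.

(** A countable set that clusters at p and only there is a nontrivial convergent
sequence.  A point q other than p has a neighbourhood that misses a
neighbourhood U of p, and only finitely many points of S lie outside U; this
isolates q. *)
Lemma sequence_intro (S : set T) (p : T) : hausdorff_space T ->
  countable S -> S p ->
  (forall U, nbhs p U -> finite_set (S `\` U)) ->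
  (forall U, nbhs p U -> exists q, [/\ S q, U q & q <> p]) ->
  closed S /\ nontrivial_convergent_sequence S.
Proof.
move=> hT cS Sp fS aS.
have /accessible_finite_set_closed clF := hausdorff_accessible hT.
have iso q : q <> p -> exists2 W, nbhs q W & W `&` S `<=` [set q].
  move=> /eqP qp; have := hT; rewrite open_hausdorff => /(_ q p qp).
  move=> [[V U] /= [/set_mem Vq /set_mem Up] [oV oU /eqP VU]].
  have fU : finite_set ((S `\` U) `\ q).
    by apply: finite_setD; apply: fS; exact: open_nbhs_nbhs.
  exists (V `&` ~` ((S `\` U) `\ q)).
    apply: open_nbhs_nbhs; split; last by split=> // -[_]; apply.
    by apply: openI => //; apply: closed_openC; exact: clF.
  move=> z [[Vz nz] Sz]; apply: contrapT => zq; apply: nz.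
  split=> //; split=> // Uz.
  by have : (V `&` U) z by []; rewrite VU.
split.
  move=> q clq; have [->//|qp] := pselect (q = p).
  by have [W /clq[z [Sz Wz]] /(_ z (conj Wz Sz)) <-] := iso q qp.
split.
  apply: eq_card_nat => //; rewrite -/(infinite_set S) => finS.
  have : nbhs p (~` (S `\ p)).
    apply: open_nbhs_nbhs; split; last by move=> [_]; apply.
    by apply: closed_openC; apply: clF; exact: finite_setD.
  by move=> /aS[q [Sq + qp]]; apply.
exists p; split=> //; apply/seteqP; split=> q.
  move=> [Sq niq]; apply: contrapT => qp; apply: niq; split; first exact/mem_set.
  have [W Wq WS] := iso q qp; exists W => //.
  apply/seteqP; split=> // _ ->; split=> //; exact: nbhs_singleton.
move=> ->; split=> // -[_ [V Vp VS]].
have [z [Sz Vz zp]] := aS V Vp.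
by have : (V `&` S) z by []; rewrite VS.
Qed.

End vietoris.

(** * Countable and locally constant data on the line *)

Section real_line.
Variable R : realType.

Lemma countable_avoid (H : set R) (l r : R) : countable H -> l < r ->
  exists2 s, l < s < r & ~ H s.
Proof.
move=> cH lr; apply: contrapT => nH.
have sub : `]l, r[%classic `<=` H.
  move=> s /=; rewrite in_itv/= => lsr; apply: contrapT => nHs.
  by apply: nH; exists s.
have c0 : countable `]l, r[%classic by apply: sub_countable cH; exact: subset_card_le.
have := countable_lebesgue_measure0 c0.
rewrite lebesgue_measure_itv/= lte_fin lr -EFinB => -[] /eqP.
by rewrite subr_eq0 => /eqP; lra.
Qed.

(** The truth set is open and closed in the connected line. *)
Lemma locally_constant (G : R -> Prop) :
  (forall t0, exists2 e, 0 < e & forall t, `|t - t0| < e -> G t <-> G t0) ->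
  forall s t, G s -> G t.
Proof.
move=> h s t Gs.
have op (H : R -> Prop) :
    (forall t0, exists2 e, 0 < e & forall t, `|t - t0| < e -> H t <-> H t0) ->
    open [set t | H t].
  move=> hH; rewrite openE => x /= Hx; have [e e0 he] := hH x.
  apply/nbhs_ballP; exists e => // y; rewrite -ball_normE /= distrC.
  by move=> /he ->.
suff : [set t | G t] = [set: R] by move=> E; have : [set: R] t by []; rewrite -E.
have cR : connected [set: R] by apply/connected_intervalP.
apply: cR; first by exists s.
  by exists [set t | G t]; [exact: op|rewrite setTI].
exists [set t | G t]; last by rewrite setTI.
rewrite -[X in closed X]setCK; apply: open_closedC; apply: op => t0.
by have [e e0 he] := h t0; exists e => // u /he ue; split=> nG Gu; apply: nG; apply/ue.
Qed.

Lemma finite_nat_bound (N : set nat) : finite_set N ->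
  exists M, forall n, (M <= n)%N -> ~ N n.
Proof.
move=> /finite_seqP[s ->]; exists (\max_(i <- s) i).+1 => n Mn /= sn.
have : (n <= \max_(i <- s) i)%N by apply: (@leq_bigmax_seq _ s xpredT id).
by rewrite leqNgt Mn.
Qed.

End real_line.

(** * An invariant of Vietoris paths *)

Section invariant.
Variable R : realType.
Variable a : nat -> R.
Hypothesis a01 : forall n, 0 <= a n <= 1.
Implicit Types (z w p : R * R) (A : set (R * R)) (P : R -> set (R * R)).
Local Notation double_fan := (double_fan a).
Local Notation tooth := (tooth a).

(** Vietoris continuity of a family of planar sets indexed by the line, in the form
that is invariant under [flip]. *)
Definition vietoris_continuous P :=
  (forall U, open U -> open [set t | P t `&` U !=set0]) /\
  (forall C, closed C -> open [set t | P t `&` C = set0]).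

Lemma vietoris_continuous_flip P :
  vietoris_continuous P -> vietoris_continuous (fun t => @flip R @^-1` P t).
Proof.
move=> [oP cP]; split=> [U oU|C cC].
  rewrite [X in open X](_ : _ = [set t | P t `&` @flip R @^-1` U !=set0]).
    by apply: oP; exact: open_flip.
  apply/seteqP; split=> t /= [z [Pz Uz]]; exists (flip z); split=> //=.
    by rewrite flipK.
  by rewrite flipK.
rewrite [X in open X](_ : _ = [set t | P t `&` @flip R @^-1` C = set0]).
  by apply: cP; exact: closed_flip.
apply/seteqP; split=> t /= /seteqP[h _]; rewrite -subset0 => z [Pz Cz].
  by apply: (h (flip z)); split; rewrite //= flipK.
by apply: (h (flip z)); split; rewrite //= flipK.
Qed.

Definition hits n (s : R) A := exists z, [/\ A z, tooth n z & s < z.2].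

(** If no point of P t0 has height s, the same holds near t0, so that for t near t0
meeting the tooth above s and meeting it at or above s amount to the same.  The
first condition is open in t and the second is closed, so both are constant on
an interval around t0 that does not depend on the tooth. *)
Lemma hits_locally_constant P (t0 s : R) :
  vietoris_continuous P -> (forall t, P t `<=` double_fan) -> 0 < s ->
  (forall z, P t0 z -> z.2 <> s) ->
  exists2 e, 0 < e & forall t u, `|t - t0| < e -> `|u - t0| < e ->
    forall n, hits n s (P t) -> hits n s (P u).
Proof.
move=> [oP cP] PX s0 Ps.
have clge := @closed_above R s; have opgt := @open_above R s.
have cleq : closed [set z : R * R | z.2 = s].
  have -> : [set z : R * R | z.2 = s] = [set z | s <= z.2] `&`
      [set z | 0 <= 0 * z.1 + (-1) * z.2 + s].
    apply/seteqP; split=> z /=; first by move=> ->; split; lra.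
    by move=> [h1 h2]; apply/eqP; rewrite eq_le; apply/andP; split; lra.
  by apply: closedI => //; exact: closed_half_plane.
have [e /= e0 he] : nbhs_ball t0 [set t | P t `&` [set z | z.2 = s] = set0].
  apply/nbhs_ballP; apply: open_nbhs_nbhs; split; first exact: cP.
  by rewrite /= -subset0 => z [/Ps].
exists e => // t u te ue n [z [Pz Tz sz]].
pose I := ball t0 e.
have inI v : `|v - t0| < e -> I v by move=> h; rewrite /I -ball_normE /= distrC.
have cI : connected I.
  apply/connected_intervalP => x y; rewrite /I -ball_normE /= => hx hy v /andP[xv vy].
  by move: hx hy; rewrite !ltr_norml => /andP[? ?] /andP[? ?]; apply/andP; split; lra.
pose U := cone n `&` [set z : R * R | s < z.2].
suff E : I `&` [set v | P v `&` U !=set0] = I.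
  have : I u by exact: inI.
  rewrite -E => -[_ [w [Pw [cw sw]]]]; exists w; split=> //.
  exact: double_fan_cone (PX _ _ Pw) cw.
apply: cI.
- exists t; split; first exact: inI.
  exists z; split=> //; split=> //; apply: tooth_cone Tz _.
  exact: lt_trans sz.
- exists [set v | P v `&` U !=set0] => //; apply: oP.
  by apply: openI => //; exact: cone_open.
- exists (~` [set v | P v `&` (tooth n `&` [set z | s <= z.2]) = set0]).
    by apply: open_closedC; apply: cP; apply: closedI => //; exact: closed_tooth.
  apply/seteqP; split=> v [Iv] /=.
    move=> [w [Pw [cw sw]]]; split=> // /seteqP[+ _] => /(_ w); apply.
    by split=> //; split; [exact: double_fan_cone (PX _ _ Pw) cw|exact: ltW].
  move=> /eqP/set0P[w [Pw [Tw sw]]]; split=> //; exists w.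
  have {}sw : s < w.2.
    rewrite lt_neqAle sw andbT; apply/eqP => ws.
    have /seteqP[h _] := he v Iv; exact: (h w).
  split=> //; split=> //; apply: tooth_cone Tw _.
  exact: lt_trans sw.
Qed.

(** The part of the definition of a nontrivial convergent sequence that passes from
the subspace to the plane. *)
Definition converges A p := countable A /\ forall U, nbhs p U -> finite_set (A `\` U).

Lemma converges_flip A p : converges A p -> converges (@flip R @^-1` A) (flip p).
Proof.
move=> [cA fA]; split; rewrite -image_flipE.
  by apply: sub_countable cA; exact: card_image_le.
move=> U pU; have -> : @flip R @` A `\` U = @flip R @` (A `\` @flip R @^-1` U).
  apply/seteqP; split=> [_ [[z Az <-] nU]|_ [z [Az nU] <-]]; first by exists z.
  by split=> //; exists z.
by apply: finite_image; apply: fA; apply: flip_continuous.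
Qed.

(** Only finitely many points of A are far from p, and off the vertex each of them
lies on at most one tooth; the other teeth meet A near p only, except perhaps at
the vertex. *)
Lemma hits_near A p (e : R) : converges A p -> 0 < e ->
  exists M, forall n, (M <= n)%N -> forall z, A z -> tooth n z -> 0 < z.2 -> ball p e z.
Proof.
move=> [_ fA] e0.
pose N := [set n | exists z, [/\ (A `\` ball p e) z, tooth n z & 0 < z.2]].
have [M hM] : exists M, forall n, (M <= n)%N -> ~ N n.
  apply: finite_nat_bound.
  apply: (@sub_finite_set _ _
    ((fun z => xget 0%N [set n | tooth n z]) @` (A `\` ball p e))).
    move=> n [z [Az Tz z0]]; exists z => //.
    case: xgetP => [m _ /= Tm|/(_ n)//]; apply: tooth_coneP Tm _.
    exact: tooth_cone Tz z0.
  by apply: finite_image; apply: fA; exact: nbhsx_ballx.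
exists M => n /hM nN z Az Tz z0; apply: contrapT => nb.
by apply: nN; exists z.
Qed.

(** The first condition makes the selected teeth converge to the spine. *)
Definition approaches (u : nat -> nat) (y : R) :=
  (forall k, (k <= u k)%N) /\
  forall e, 0 < e -> exists N, forall k, (N <= k)%N -> `|a (u k) - y| < e.

(** The height s is only required to be positive: for a convergent A it can then be
any height below that of the limit, see [caught_all]. *)
Definition caught u A :=
  exists2 s, 0 < s & exists N, forall k, (N <= k)%N -> hits (u k) s A.

Lemma caught_near u y A p e : approaches u y -> converges A p -> caught u A ->
  0 < e -> exists M, forall k, (M <= k)%N -> exists z,
    [/\ A z, tooth (u k) z, ball p e z, 0 <= z.1 < e & z.2 < y + e].
Proof.
move=> [uk uy] cA [s s0 [N hN]] e0.
have [M1 h1] := hits_near cA e0; have [M2 h2] := uy e e0.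
have [M3 h3] := small_natV e0.
exists (N + M1 + M2 + M3)%N => k hk.
have Nk : (N <= k)%N by apply: leq_trans hk; rewrite -!addnA leq_addr.
have [z [Az Tz sz]] := hN k Nk.
exists z; split=> //.
- apply: (h1 (u k)) Az Tz _; last exact: lt_trans sz.
  apply: leq_trans (uk k); apply: leq_trans hk.
  by rewrite -!addnA addnCA leq_addr.
- have [/andP[-> z1] _] := tooth_bounds a01 Tz; apply: le_lt_trans h3.
  apply: le_trans z1 _; rewrite lef_pV2 ?posrE// ler_nat ltnS.
  by apply: leq_trans (uk k); apply: leq_trans hk; exact: leq_addl.
- have : `|a (u k) - y| < e.
    by apply: h2; apply: leq_trans hk; rewrite -addnA addnCA leq_addr.
  by case: Tz => _ za _; rewrite ltr_norml => /andP[]; lra.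
Qed.

(** Points of A on infinitely many teeth must converge to the limit p of A; the
teeth close up on the spine, and those selected by u end at heights that tend
to y. *)
Lemma caught_limit u y A p : approaches u y -> converges A p -> caught u A ->
  p.1 = 0 /\ p.2 <= y.
Proof.
move=> uy cA cu.
have key e : 0 < e -> `|p.1| < 2 * e /\ p.2 < y + 2 * e.
  move=> e0; have [M /(_ M (leqnn M))] := caught_near uy cA cu e0.
  move=> [z [_ _ /ball_planeP[]]]; rewrite !ltr_norml.
  by move=> /andP[? ?] /andP[? ?] /andP[? ?] ?; split; [apply/andP; split|]; lra.
split.
  apply/eqP; rewrite -normr_eq0 eq_le normr_ge0 andbT leNgt; apply/negP => p0.
  by have [] := key (`|p.1| / 2); lra.
rewrite leNgt; apply/negP => yp.
by have [] := key ((p.2 - y) / 2); lra.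
Qed.

Lemma caught_all u y A p (s : R) : approaches u y -> converges A p -> caught u A ->
  s < p.2 -> exists N, forall k, (N <= k)%N -> hits (u k) s A.
Proof.
move=> uy cA cu sp; have e0 : 0 < p.2 - s by lra.
have [M hM] := caught_near uy cA cu e0; exists M => k /hM[z].
move=> [Az Tz /ball_planeP[_]]; rewrite ltr_norml => /andP[_ ?] _ _.
by exists z; split=> //; lra.
Qed.

(** The invariant.  The first half keeps the limit of A on the spine at or below y,
the second half at or above y; hence [trapped_limit]. *)
Definition trapped u v A := caught u A /\ caught v (@flip R @^-1` A).

Lemma trapped_limit u v y A p : approaches u y -> approaches v (1 - y) ->
  converges A p -> trapped u v A -> p = (0, y).
Proof.
move=> uy vy cA [cu cv].
have [p1 p2] := caught_limit uy cA cu.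
have [_ /= p3] := caught_limit vy (converges_flip cA) cv.
rewrite [p]surjective_pairing p1; congr pair.
by apply/eqP; rewrite eq_le p2; lra.
Qed.

(** A convergent sequence is countable, hence omits almost every height. *)
Lemma generic_height A (l r : R) : countable A -> l < r ->
  exists2 s, l < s < r & forall z, A z -> z.2 <> s.
Proof.
move=> cA lr; have [|s ls nH] := @countable_avoid _ (snd @` A) _ _ _ lr.
  by apply: sub_countable cA; exact: card_image_le.
by exists s => // z Az zs; apply: nH; exists z.
Qed.

Lemma caught_locally_constant P u y t0 :
  vietoris_continuous P -> (forall t, P t `<=` double_fan) ->
  countable (P t0) -> 0 < y -> exists2 e, 0 < e &
  forall t t' p, `|t - t0| < e -> `|t' - t0| < e -> converges (P t) p ->
    p.2 = y -> approaches u y -> caught u (P t) -> caught u (P t').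
Proof.
move=> vP PX cP y0; have [s /andP[s0 sy] hs] := generic_height cP y0.
have [e e0 he] := hits_locally_constant vP PX s0 hs.
exists e => // t t' p te t'e cvP py uy cu.
have [|N hN] := caught_all (s := s) uy cvP cu; first by rewrite py.
by exists s => //; exists N => k /hN; exact: he.
Qed.

(** Being trapped is a locally constant property along a Vietoris path.  At a time t0
the countable set P t0 omits some height s between 0 and y.  A trapped set
converges to (0, y), so almost all of its teeth are met above s, and by
[hits_locally_constant] this persists for all t near t0; likewise for the other
fan. *)
Lemma trapped_invariant P u v y :
  vietoris_continuous P -> (forall t, P t `<=` double_fan) ->
  (forall t, exists p, converges (P t) p) ->
  approaches u y -> approaches v (1 - y) -> 0 < y < 1 ->
  forall s t, trapped u v (P s) -> trapped u v (P t).
Proof.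
move=> vP PX cP uy vy /andP[y0 y1].
apply: locally_constant => t0.
have [p0 [c0 _]] := cP t0.
have [e e0 he] := caught_locally_constant u vP PX c0 y0.
have PX' t : @flip R @^-1` P t `<=` double_fan by move=> z /PX; rewrite double_fan_flip.
have c0' : countable (@flip R @^-1` P t0).
  by rewrite -image_flipE; apply: sub_countable c0; exact: card_image_le.
have y1' : 0 < 1 - y by lra.
have [e' e'0 he'] := caught_locally_constant v (vietoris_continuous_flip vP) PX' c0' y1'.
exists (Num.min e e'); first by rewrite lt_min e0.
have key t t' : `|t - t0| < Num.min e e' -> `|t' - t0| < Num.min e e' ->
    trapped u v (P t) -> trapped u v (P t').
  rewrite !lt_min => /andP[te te'] /andP[t'e t'e'] tr.
  have [p cp] := cP t; have pE := trapped_limit uy vy cp tr.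
  case: tr => cu cv; split.
    by apply: (he t t' p) => //; rewrite pE.
  by apply: (he' t t' (flip p)) => //; [exact: converges_flip|rewrite pE].
move=> t te; have t0e : `|t0 - t0| < Num.min e e'.
  by rewrite subrr normr0 lt_min e0.
by split; exact: key.
Qed.

End invariant.

(** * Coding planar closed sets by reals, and a dense family of tooth heights *)

Section cardinality.
Variable R : realType.

Definition partial (b : nat -> bool) (n : nat) : R :=
  \sum_(i < n) (b i)%:R * (3^-1) ^+ i.

(** The factor 3/2 is the sum of the geometric series of ratio 1/3. *)
Lemma partial_tail b n m :
  partial b (n + m) <= partial b n + 3 / 2 * ((3^-1) ^+ n - (3^-1) ^+ (n + m)).
Proof.
elim: m => [|m IH]; first by rewrite addn0 subrr mulr0 addr0.
rewrite addnS /partial big_ord_recr /= -/(partial _ _) exprS.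
have h : 0 <= (3^-1 : R) ^+ (n + m) by apply: exprn_ge0.
have : (b (n + m)%N)%:R * (3^-1 : R) ^+ (n + m) <= 3^-1 ^+ (n + m).
  by case: (b _); rewrite ?mul1r ?mul0r.
by move: IH; rewrite /partial; lra.
Qed.

Lemma partial_le b n m : partial b n <= partial b (n + m).
Proof.
elim: m => [|m IH]; first by rewrite addn0.
rewrite addnS; apply: le_trans IH _.
by rewrite /partial big_ord_recr /= lerDl mulr_ge0// exprn_ge0.
Qed.

(** The real number with the digits b in base 3; as the digits are 0 or 1, it
determines them. *)
Definition ternary (b : nat -> bool) : R := sup (range (partial b)).

Lemma partial_ub b n k : partial b k <= partial b n + 3 / 2 * (3^-1) ^+ n.
Proof.
have h i : 0 <= (3^-1 : R) ^+ i by apply: exprn_ge0.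
have [kn|/ltnW nk] := leqP k n.
  by have := partial_le b k (n - k); rewrite subnKC//; have := h n; lra.
by have := partial_tail b n (k - n); rewrite subnKC//; have := h k; lra.
Qed.

(** At the first difference c gains 3^-n, and all later digits of b together
contribute at most half of that. *)
Lemma ternary_lt b c n : (forall i, (i < n)%N -> b i = c i) ->
  b n = false -> c n = true -> ternary b < ternary c.
Proof.
move=> bc bn cn; have h : 0 < (3^-1 : R) ^+ n by apply: exprn_gt0.
have e : partial b n = partial c n.
  by apply: eq_bigr => i _; rewrite bc.
have lb : ternary b <= partial b n.+1 + 3 / 2 * (3^-1) ^+ n.+1.
  apply: ge_sup; first by exists (partial b 0), 0%N.
  by move=> _ [k _ <-]; exact: partial_ub.
have lc : partial c n.+1 <= ternary c.
  apply: ub_le_sup; last by exists n.+1.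
  by exists (partial c 0 + 3 / 2 * (3^-1) ^+ 0) => _ [k _ <-]; exact: partial_ub.
apply: le_lt_trans lb _; apply: lt_le_trans lc.
rewrite /partial !big_ord_recr /= -/(partial b n) -/(partial c n) e bn cn exprS /=.
by rewrite mul0r mul1r; lra.
Qed.

Lemma ternary_inj : injective ternary.
Proof.
move=> b c bc; apply: contrapT => /eqP bNc.
have ex : exists n, b n != c n.
  apply: contrapT => nex; move/eqP: bNc; apply; apply/funext => n.
  by apply/eqP; apply: contrapT => /negP h; apply: nex; exists n.
have lt n : (n < ex_minn ex)%N -> b n = c n.
  by case: ex_minnP => m _ hm nm; apply/eqP; apply: contraLR nm => /hm; rewrite -leqNgt.
have : b (ex_minn ex) != c (ex_minn ex) by case: ex_minnP.
case Eb : (b _); case Ec : (c _) => // _.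
  by have := @ternary_lt c b _ (fun i h => esym (lt i h)) Ec Eb; rewrite bc ltxx.
by have := @ternary_lt b c _ lt Eb Ec; rewrite bc ltxx.
Qed.

(** A closed set is determined by the rational balls that it misses; this records
them along an enumeration. *)
Definition missed_balls (A : set (R * R)) (n : nat) : bool :=
  if @unpickle (rat * rat * nat)%type n is Some q then
    `[< A `&` ball (ratr q.1.1 : R, ratr q.1.2 : R) (q.2.+1%:R^-1) = set0 >]
  else false.

Lemma rational_near (x e : R) : 0 < e -> exists q : rat, `|ratr q - x| < e.
Proof.
move=> e0; have /rat_in_itvoo[q] : x < x + e by rewrite ltrDl.
rewrite in_itv/= => /andP[xq qx]; exists q.
by rewrite gtr0_norm ?subr_gt0// ltrBlDl.
Qed.

(** A point outside the closed set B lies in a rational ball that misses B. *)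
Lemma missed_balls_sub (A B : set (R * R)) :
  closed B -> missed_balls A = missed_balls B -> A `<=` B.
Proof.
move=> cB AB z Az; apply: contrapT => nBz.
have [e /= e0 be] : nbhs_ball z (~` B).
  by apply/nbhs_ballP; apply: open_nbhs_nbhs; split=> //; exact: closed_openC.
have [n ne] : exists n, n.+1%:R^-1 < e / 2 by apply: small_natV; lra.
have n0 : 0 < n.+1%:R^-1 :> R by rewrite invr_gt0.
have [q1 h1] := rational_near z.1 n0; have [q2 h2] := rational_near z.2 n0.
have /(congr1 (fun f => f (pickle (q1, q2, n)))) := AB.
rewrite /missed_balls pickleK /=.
set b := ball _ _ => E.
have bz : b z by apply: ball_plane.
have bB : B `&` b = set0.
  rewrite -subset0 => w [Bw bw]; apply: (be w) => //.
  apply: le_ball (ball_triangle (ball_sym bz) bw).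
  by rewrite [leRHS]splitr lerD// ltW.
have : `[< B `&` b = set0 >] by apply/asboolP.
by rewrite -E => /asboolP/seteqP[/(_ z) h _]; exact: h.
Qed.

(** The heights run through the dyadic numbers, level by level: for k the binary
logarithm of n, [a n] is (n - 2^k) / 2^k.  Choosing at each level the dyadic
number just below y gives the selection u. *)
Lemma dense_teeth : exists a : nat -> R, (forall n, 0 <= a n <= 1) /\
  forall y, 0 < y < 1 -> exists u, approaches a u y.
Proof.
pose a n : R := (n - 2 ^ trunc_log 2 n)%:R / (2 ^ trunc_log 2 n)%:R.
exists a; split=> [n|y /andP[y0 y1]].
  rewrite divr_ge0//= ler_pdivrMr ?mul1r ?ltr0n ?expn_gt0// ler_nat.
  by rewrite leq_subLR addnn -mul2n -expnS ltnW// trunc_log_ltn.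
pose j k := Num.truncn (y * (2 ^ k)%:R).
have p2 k : 0 < (2 ^ k)%:R :> R by rewrite ltr0n expn_gt0.
have jP k : (j k)%:R <= y * (2 ^ k)%:R < (j k).+1%:R.
  by apply: Num.Theory.truncn_itv; rewrite mulr_ge0// ltW.
have jlt k : (j k < 2 ^ k)%N.
  have /andP[h _] := jP k; rewrite -(ltr_nat R); apply: le_lt_trans h _.
  by rewrite -[ltRHS]mul1r ltr_pM2r.
exists (fun k => 2 ^ k + j k)%N; split=> [k|e e0].
  exact: leq_trans (ltnW (ltn_expl k _)) (leq_addr _ _).
have [N Ne] := small_natV e0; exists N => k Nk.
have tk : trunc_log 2 (2 ^ k + j k) = k.
  by apply: trunc_log_eq; rewrite // leq_addr /= expnS mul2n -addnn ltn_add2l.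
rewrite /a tk addnC addnK.
have /andP[h1 h2] := jP k; apply: le_lt_trans Ne.
have hk : (2 ^ k)%:R^-1 <= N.+1%:R^-1 :> R.
  rewrite lef_pV2 ?posrE// ler_nat; apply: leq_ltn_trans Nk _.
  exact: ltn_expl.
apply: le_trans hk; rewrite distrC ger0_norm ?subr_ge0 ?ler_pdivrMr//.
rewrite lerBlDr -[X in X + _]mul1r -mulrDl ler_pdivlMr// addrC natr1.
exact: ltW.
Qed.

End cardinality.

(** * Counting the path components *)

Section components.
Variable R : realType.
Variable a : nat -> R.
Hypothesis a01 : forall n, 0 <= a n <= 1.
Local Notation X := (set_type (double_fan a)).
Local Notation SX := (set_type (Sc X)).

Definition points (F : CL X) : set (R * R) := (fun x : X => \val x) @` CL_set F.

Lemma points_meet (F : CL X) (U : set (R * R)) :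
  points F `&` U !=set0 <-> CL_set F `&` (fun x : X => \val x) @^-1` U !=set0.
Proof.
split=> [[_ [[x Fx <-] Ux]]|[x [Fx Ux]]]; first by exists x.
by exists (\val x); split=> //; exists x.
Qed.

Lemma points_double_fan F : points F `<=` double_fan a.
Proof. by move=> _ [x _ <-]; exact: set_valP. Qed.

Lemma closed_points F : closed (points F).
Proof.
apply: compact_closed; first exact: norm_hausdorff.
apply: continuous_compact; first exact/continuous_subspaceT/val_continuous.
have cX : compact [set: X] by apply: compact_sub; exact: compact_double_fan.
by have [clF _] := CL_setP F; exact: (subclosed_compact clF cX).
Qed.

Lemma points_inj (F G : CL X) : points F = points G -> F = G.
Proof.
move=> FG; apply: val_inj; have E (A : CL X) x : CL_set A x <-> points A (\val x).
  by split=> [Ax|[y Ay /val_inj <-]//]; exists x.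
by apply/seteqP; split=> x /E; [rewrite FG|rewrite -FG] => /E.
Qed.

Lemma points_converge (F : SX) : exists p, converges (points (\val F)) p.
Proof.
have [cF [xS [_ fF]]] := set_valP F.
exists (\val xS); split.
  apply: (sub_countable (card_image_le _ _)).
  by rewrite /countable; have /card_eqPle[] := cF.
move=> U /val_continuous /fF h; apply: sub_finite_set (finite_image (fun x : X => \val x) h).
by move=> _ [[x Fx <-] nU]; exists x.
Qed.

(** The two subbasic kinds of Vietoris open sets, pulled back along the path. *)
Lemma path_vietoris_continuous (x y : SX) (p : {path unit_interval R from x to y}) :
  vietoris_continuous (fun t => points (\val (p (clamp t)))).
Proof.
have cp : continuous (fun t => \val (p (clamp t))).
  apply: (comp_continuous _ (@val_continuous _ (Sc X))).
  by apply: (comp_continuous _ (@cts_fun _ _ p)); exact: clamp_continuous.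
have pre (U : set (CL X)) : open U -> open [set t | U (\val (p (clamp t)))].
  by move: cp => /continuousP; apply.
split=> [U oU|C cC].
  have oV : open ((fun x : X => \val x) @^-1` U).
    by have /continuousP := @val_continuous _ (double_fan a); apply.
  have := pre _ (open_meets oV); congr open; apply/seteqP.
  by split=> t /points_meet.
have cV : closed ((fun x : X => \val x) @^-1` C).
  by have /continuous_closedP := @val_continuous _ (double_fan a); apply.
have := pre _ (open_misses cV); congr open; apply/seteqP.
split=> t /= E; apply: contrapT => /eqP/set0P h.
  by have /points_meet := h; rewrite E => -[].
by have /points_meet := h; rewrite E => -[].
Qed.

Lemma trapped_component (F G : SX) u v y : 0 < y < 1 ->
  approaches a u y -> approaches a v (1 - y) ->
  path_component R SX F G -> trapped a u v (points (\val F)) ->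
  trapped a u v (points (\val G)).
Proof.
move=> y01 uy vy [p] tF.
have PX t : points (\val (p (clamp t))) `<=` double_fan a by exact: points_double_fan.
have cP t : exists q, converges (points (\val (p (clamp t)))) q.
  exact: points_converge.
have p0 : p (clamp 0) = F by rewrite clamp0; exact: path_zero.
have p1 : p (clamp 1) = G by rewrite clamp1; exact: path_one.
rewrite -p1; rewrite -p0 in tF.
exact: (trapped_invariant a01 (path_vietoris_continuous p) PX cP uy vy y01 1 tF).
Qed.

Section tips.
Variables (u v : nat -> nat) (y : R).
Hypotheses (y01 : 0 < y < 1) (uy : approaches a u y) (vy : approaches a v (1 - y)).

Definition tip n : R * R := tooth_pt n (a n).

Lemma tip_double_fan n : double_fan a (tip n).
Proof.
apply: (@tooth_double_fan _ _ n); apply: tooth_pt_tooth.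
by have /andP[-> _] := a01 n; rewrite /=.
Qed.

Lemma tip_near w x (e : R) : approaches a w x -> 0 < e ->
  exists N, forall k, (N <= k)%N -> ball (0, x) e (tip (w k)).
Proof.
move=> [wk wx] e0; have [N hN] := wx e e0; have [M hM] := small_natV e0.
exists (N + M)%N => k hk; apply: ball_plane; rewrite /=.
  rewrite sub0r normrN.
  have T : tooth a (w k) (tip (w k)).
    by apply: tooth_pt_tooth; have /andP[-> _] := a01 (w k); rewrite /=.
  have [/andP[/= x0 x1] _] := tooth_bounds a01 T.
  rewrite ger0_norm//; apply: le_lt_trans hM; apply: le_trans x1 _.
  rewrite lef_pV2 ?posrE// ler_nat ltnS; apply: leq_trans (wk k).
  by apply: leq_trans hk; exact: leq_addl.
by rewrite distrC; apply: hN; apply: leq_trans hk; exact: leq_addr.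
Qed.

Lemma tip_neq n x : 0 < x -> tip n <> (0, x).
Proof.
move=> x0 /pair_equal_spec[+ ax]; rewrite ax => /eqP.
by rewrite mulf_eq0 invr_eq0 pnatr_eq0/= gt_eqF.
Qed.

(** Both families of tips converge to (0, y).  Near that point the teeth of the right
fan lie below their tips and those of the left fan above theirs, so that neither
upward nor downward motion is possible for all tips at once. *)
Definition tips : set (R * R) :=
  [set (0, y)] `|` (range (tip \o u) `|` range (@flip R \o tip \o v)).

Lemma tips_double_fan : tips `<=` double_fan a.
Proof.
move=> _ [->|[[k _ <-]|[k _ <-]]].
- by apply: spine_double_fan; case/andP: y01 => /ltW-> /ltW->.
- exact: tip_double_fan.
- by rewrite /= double_fan_flip; exact: tip_double_fan.
Qed.

Lemma ball_flip (p z : R * R) (e : R) : ball (flip p) e (flip z) -> ball p e z.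
Proof.
move=> /ball_planeP[/= h1 h2]; apply: ball_plane.
  by move: h1; rewrite -opprD normrN.
by move: h2; rewrite (_ : 1 - _ - _ = - (p.2 - z.2)) ?normrN//; lra.
Qed.

Lemma flip_tip_near (e : R) : 0 < e ->
  exists N, forall k, (N <= k)%N -> ball (0, y) e (flip (tip (v k))).
Proof.
move=> e0; have [N hN] := tip_near vy e0; exists N => k Nk.
apply: ball_flip; rewrite flipK; have := hN k Nk.
by rewrite /flip/= oppr0.
Qed.

Definition tip_seq : set X := (fun x : X => \val x) @^-1` tips.

Lemma tip_seqP : closed tip_seq /\ nontrivial_convergent_sequence tip_seq.
Proof.
have y0 : 0 < y by case/andP: y01.
have py : double_fan a (0, y) by apply: tips_double_fan; left.
pose p : X := exist _ (0, y) (mem_set py).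
apply: (@sequence_intro _ _ p).
- by apply: hausdorff_sub; exact: norm_hausdorff.
- apply: (@sub_countable _ _ _ tips).
    by apply: card_ge_preimage => ? ? _ _; exact: val_inj.
  rewrite /tips.
  have cr (f : nat -> R * R) : countable (range f).
    exact: sub_countable (card_image_le _ _) (countableP _).
  have cU (A B : set (R * R)) : countable A -> countable B -> countable (A `|` B).
    move=> cA cB; rewrite -bigcup2E; apply: bigcup_countable => // i _.
    by case: i => [//|[//|i]] /=; exact: countable0.
  exact: cU (countable1 _) (cU _ _ (cr _) (cr _)).
- by left.
- move=> W /nbhs_ballP[e /= e0 be].
  have [N1 h1] := tip_near uy e0; have [N2 h2] := flip_tip_near e0.
  apply: (@sub_finite_set _ _ ((fun x : X => \val x) @^-1`
    ((tip \o u) @` `I_N1 `|` (@flip R \o tip \o v) @` `I_N2))).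
    move=> x [Tx nW]; have nb : ~ ball (0, y) e (\val x) by move=> /be.
    case: Tx => [xE|[[k _ xE]|[k _ xE]]].
    + by case: nb; rewrite xE; exact: ballxx.
    + left; exists k => //=; rewrite ltnNge; apply/negP => /h1.
      by move: xE => /= ->.
    + right; exists k => //=; rewrite ltnNge; apply/negP => /h2.
      by move: xE => /= ->.
  apply: finite_preimage; first by move=> ? ? _ _; exact: val_inj.
  by rewrite finite_setU; split; apply: finite_image; exact: finite_II.
- move=> W /nbhs_ballP[e /= e0 be]; have [N h] := tip_near uy e0.
  have q := tip_double_fan (u N); exists (exist _ (tip (u N)) (mem_set q)).
  split; first by right; left; exists N.
    by apply: be; rewrite -initial_ballE; exact: h.
  by move=> /(congr1 \val)/=; exact: tip_neq.
Qed.

Lemma tips_trapped : trapped a u v tips.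
Proof.
have main w x (A : set (R * R)) : 0 < x -> approaches a w x ->
    (forall k, A (tip (w k))) -> caught a w A.
  move=> x0 [_ wx] Aw; exists (x / 2); first by lra.
  have [|N hN] := wx (x / 2); first by lra.
  exists N => k /hN h; exists (tip (w k)); split=> //.
    by apply: tooth_pt_tooth; have /andP[-> _] := a01 (w k); rewrite /=.
  by move: h; rewrite ltr_norml /= => /andP[]; lra.
case/andP: y01 => y0 y1; split; first by apply: main uy _ => // k; right; left; exists k.
apply: main vy _ => [|k]; first by lra.
by right; right; exists k.
Qed.

Lemma tip_seq_exists : exists F : SX, points (\val F) = tips.
Proof.
have [clS ntS] := tip_seqP.
have nS : tip_seq !=set0.
  have q := tip_double_fan (u 0); exists (exist _ (tip (u 0)) (mem_set q)).
  by right; left; exists 0%N.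
pose F : CL X := exist _ tip_seq (mem_set (conj clS nS)).
have SF : Sc X F by [].
exists (exist _ F (mem_set SF)); apply/seteqP; split=> [_ [x Tx <-]//|z Tz].
by exists (exist _ z (mem_set (tips_double_fan Tz))).
Qed.

End tips.

Lemma components_le : (path_components R SX #<= [set: R])%card.
Proof.
apply: card_le_trans (card_image_le _ _) _; apply/pcard_injP.
exists (fun F : SX => ternary R (missed_balls (points (\val F)))) => F G _ _ /ternary_inj FG.
apply: val_inj; apply: points_inj; apply/seteqP; split.
  by apply: missed_balls_sub FG; exact: closed_points.
by apply: missed_balls_sub (esym FG); exact: closed_points.
Qed.

(** For each y in the open unit interval, the tips at level y form a convergent
sequence that is trapped at level y.  If two such sequences were in one path
component, one of them would be trapped at both levels, so its limit would
determine both of them. *)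
Lemma components_ge :
  (forall y, 0 < y < 1 -> exists u, approaches a u y) ->
  ([set: R] #<= path_components R SX)%card.
Proof.
(* [h] is an injection of the line into the open unit interval. *)
move=> ha; pose h (x : R) : R := (1 + expR x)^-1.
have h01 x : 0 < h x < 1.
  have e0 := expR_gt0 x.
  by rewrite /h invr_gt0 invf_lt1; [apply/andP; split|]; lra.
have h10 x : 0 < 1 - h x < 1 by have := h01 x; lra.
have hinj : injective h by move=> x x' /invr_inj /addrI /expR_inj.
pose u x := sval (cid (ha _ (h01 x))); pose v x := sval (cid (ha _ (h10 x))).
have uP x : approaches a (u x) (h x) by rewrite /u; case: cid.
have vP x : approaches a (v x) (1 - h x) by rewrite /v; case: cid.
pose F x := sval (cid (tip_seq_exists (h01 x) (uP x) (vP x))).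
have FP x : points (\val (F x)) = tips (u x) (v x) (h x) by rewrite /F; case: cid.
pose comp x := path_component R SX (F x).
have cinj : injective comp.
  move=> x x' e.
  have Fx' : path_component R SX (F x) (F x').
    have : path_component R SX (F x') (F x').
      by split; exact: (cst (F x')).
    by rewrite -[path_component R SX (F x')]/(comp x') -e.
  have tx : trapped a (u x) (v x) (points (\val (F x))).
    by rewrite FP; exact: tips_trapped.
  have tx' := trapped_component (h01 x) (uP x) (vP x) Fx' tx.
  have tx'' : trapped a (u x') (v x') (points (\val (F x'))).
    by rewrite FP; exact: tips_trapped.
  have [p cp] := points_converge (F x').
  have e1 := trapped_limit a01 (uP x) (vP x) cp tx'.
  have e2 := trapped_limit a01 (uP x') (vP x') cp tx''.
  by apply: hinj; move: e1; rewrite e2 => -[].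
have : (comp @` [set: R] #= [set: R])%card by apply: inj_card_eq => ? ? _ _; exact: cinj.
rewrite card_eq_sym => /card_eqPle[le _]; apply: card_le_trans le _.
by apply: subset_card_le => _ [x _ <-]; exists (F x).
Qed.

End components.

Theorem mainTheorem5 (R : realType) :
  exists X : set (R * R)%type,
    dendroid R X /\ (path_components R (Sc X) #= [set: R])%card.
Proof.
have [a [a01 ha]] := dense_teeth R.
exists (double_fan a); split; first exact: dendroid_double_fan.
by apply/card_eqPle; split; [exact: components_le|exact: components_ge].
Qed.
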